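(* If $\sigma_n \to \infty$ as $n\to\infty$ ($n\in\mathbb{N}$), then $$\frac{R_n-\mu(n)}{\sigma_n} \longrightarrow N(0,1)$$ in distribution as $n\to\infty$, where $N(0,1)$ is the standard normal law.
   Context: Let $\pi=(\pi_i)_{i\ge 1}$ be a probability measure on the natural numbers $\mathbb{N}=\{1,2,\dots\}$ with $\pi_i\ge \pi_{i+1}>0$ for all $i\ge 1$. Let $\{\xi_n\}_{n\ge 1}$ be i.i.d. random variables with common law $\pi$, and let $R_n:=\#\{\xi_k:1\le k\le n\}$ be the number of distinct values among the first $n$ of them. For $t\ge 0$ put $$\mu(t):=\sum_{i=1}^\infty\bigl[1-e^{-t\pi_i}\bigr],\qquad \sigma_t:=\sqrt{\mu(2t)-\mu(t)}.$$ *)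

(* Defs.v *)
From HB Require Import structures.
From mathcomp Require Import all_boot all_order all_algebra finmap.
From mathcomp Require Import all_classical all_reals all_analysis.

Set Implicit Arguments.
Unset Strict Implicit.
Unset Printing Implicit Defensive.

Import Order.TTheory GRing.Theory Num.Theory.
Import numFieldNormedType.Exports.

Local Open Scope classical_set_scope.
Local Open Scope ring_scope.

(* Mutual independence: the product rule for every finite subfamily. *)
Definition mutually_independent d d' (T : measurableType d)
    (T' : measurableType d') (R : realType) (P : probability T R)
    (I : choiceType) (X : I -> {RV P >-> T'}) :=
  forall (J : {fset I}) (B : I -> set T'),
    (forall i, measurable (B i)) ->
    P (\bigcap_(i in [set` J]) (X i @^-1` B i)) =
    (\prod_(i <- J) P (X i @^-1` B i))%E.
Arguments mutually_independent {d d' T T' R} P {I} X.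

Definition iid d d' (T : measurableType d) (T' : measurableType d')
    (R : realType) (P : probability T R) (X : nat -> {RV P >-> T'})
    (nu : probability T' R) :=
  mutually_independent P X /\
  forall k (B : set T'), measurable B -> distribution P (X k) B = nu B.
Arguments iid {d d' T T' R} P X nu.

(* Pointwise convergence of the distribution functions at every continuity
   point of the limiting one. The type of [nu] is that of the probabilities on
   the Borel sets of R for the display carried by [normal_prob]. *)
Definition cvg_in_distribution d (T : measurableType d) (R : realType)
    (P : probability T R) (X : nat -> {RV P >-> R}) (nu : probability (g_sigma_algebraType R.-ocitv.-measurable) R) :=
  forall x : R, {for x, continuous (fun r : R => nu `]-oo, r]%classic)} ->
    cdf (X n) x @[n --> \oo] --> nu `]-oo, x]%classic.
Arguments cvg_in_distribution {d T R} P X nu.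

(* The positive integers {1, 2, ...} are represented by nat through the shift
   i |-> i.+1: [mass p i] is pi_(i+1), and X 0, ..., X n.-1 are the first n
   terms of the sequence of random variables. *)
Definition mass (R : realType) (p : probability nat R) (i : nat) : R :=
  fine (p [set i]).

Definition mu (R : realType) (p : probability nat R) (t : R) : R :=
  limn (series (fun i => 1 - expR (- (t * mass p i)))).

Definition sigma (R : realType) (p : probability nat R) (t : R) : R :=
  Num.sqrt (mu p (2 * t) - mu p t).

(* By this lemma [mu p t] is a genuine sum for t >= 0. *)
Lemma is_cvg_series_mu (R : realType) (p : probability nat R) (t : R) :
  0 <= t -> cvgn (series (fun i => 1 - expR (- (t * mass p i)))).
Proof.
move=> t0.
have mass_ge0 i : 0 <= mass p i by rewrite fine_ge0.
have mass_sum n : \sum_(0 <= i < n) mass p i <= 1.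
  rewrite -lee_fin -sumEFin.
  under eq_bigr do rewrite fineK ?fin_num_measure//.
  rewrite big_mkord -(measure_semi_additive_ord p (F := fun i : 'I_n => [set val i])).
  - exact: probability_le1.
  - by [].
  - move=> i j _ _ [x [/= -> ij]]; exact/val_inj.
  - by [].
apply: nondecreasing_is_cvgn.
  apply/nondecreasing_series => i _ _.
  by rewrite subr_ge0 -expR0 ler_expR oppr_le0 mulr_ge0.
exists t => _ [n _ <-]; rewrite -[leRHS]mulr1.
apply: le_trans (ler_wpM2l t0 (mass_sum n)).
rewrite mulr_sumr; apply: ler_sum => i _.
by rewrite lerBlDr -lerBlDl; exact: expR_ge1Dx.
Qed.

Section nb_distinct.
Context d (T : measurableType d).
Variables (X : nat -> {mfun T >-> nat}) (n : nat).

Definition nb_distinct (w : T) : nat :=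
  size (undup [seq X k w | k <- iota 0 n]).

Lemma measurable_fun_iota (f : seq nat -> nat) m :
  measurable_fun [set: T] (fun w => f [seq X k w | k <- iota 0 m]).
Proof.
elim: m f => [|m IHm] f; first exact: (@measurable_cst _ _ _ _ setT (f [::])).
move=> _ A _; rewrite setTI.
rewrite (_ : _ @^-1` A = \bigcup_j ((X m @^-1` [set j]) `&`
    ((fun w => f (rcons [seq X k w | k <- iota 0 m] j)) @^-1` A))); last first.
  have mapS w : [seq X k w | k <- iota 0 m.+1] =
      rcons [seq X k w | k <- iota 0 m] (X m w).
    by rewrite -map_rcons -addn1 iotaD cats1.
  apply/seteqP; split => [w|w [j _ []]].
    by rewrite /preimage /mkset mapS => Aw; exists (X m w).
  by rewrite /preimage /mkset mapS => ->.
apply: bigcup_measurable => j _; apply: measurableI.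
  by apply: measurable_funPTI.
rewrite -[X in measurable X]setTI.
exact: (IHm (fun s => f (rcons s j))).
Qed.

HB.instance Definition _ := isMeasurableFun.Build _ _ _ _ nb_distinct
  (measurable_fun_iota (size \o undup) n).

End nb_distinct.

Section standardized.
Context d (T : measurableType d) (R : realType).
Variables (X : {mfun T >-> nat}) (a b : R).

Definition standardized (w : T) : R := ((X w)%:R - a) / b.

Lemma measurable_standardized : measurable_fun [set: T] standardized.
Proof.
apply: (@measurableT_comp _ _ _ _ _ _ (fun k : nat => (k%:R - a) / b)) => //.
Qed.

HB.instance Definition _ := isMeasurableFun.Build _ _ _ _ standardized
  measurable_standardized.

End standardized.

(* Main.v *)
(** The proof runs Stein's method directly on the multinomial sample, without
    Poissonization. Put [q_i = (1 - pi_i)^n]. Conditioning on box [i] staying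
    empty hardly changes the law of the number of other occupied boxes: redoing
    the draws one at a time, the expectation of a 1-Lipschitz function changes
    by at most [n pi_i (1 - pi_i)^(n-1) beta / q_i], where
    [beta = sum_j pi_j (1 - pi_j)^(n-1)] is the probability that a given draw
    is not repeated. Hence, with [W = (R_n - mu n) / sigma_n],
    [E (W F(W) - F'(W))] is at most a constant times
    [1 / sigma_n + n beta^2 / sigma_n^2], for [F] bounded with a bounded
    Lipschitz derivative. By Cauchy-Schwarz outside finitely many boxes,
    [n beta^2 = o(sigma_n^2)]. The test function [atan] yields tightness, and
    compactly supported solutions of Stein's equation then yield the limits of
    the distribution functions. All sums are finite because all boxes from some
    [N] on, depending on [n], are merged into one that is unlikely to be hit. *)

Require Import Defs.
From HB Require Import structures.
From mathcomp Require Import all_boot all_order all_algebra finmap.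
From mathcomp Require Import all_classical all_reals all_analysis.
From mathcomp Require Import measurable_realfun ring lra.
Import Order.TTheory GRing.Theory Num.Theory.
Import numFieldNormedType.Exports.
Local Open Scope classical_set_scope.
Local Open Scope ring_scope.

Set Implicit Arguments.
Unset Strict Implicit.
Unset Printing Implicit Defensive.

(** * Occupied boxes in a finite multinomial sample *)

Section occupied_set.
Import fintype boot.finset.
Local Open Scope set_scope.
Local Open Scope ring_scope.
Variables (R : realFieldType) (I : finType) (w : I -> R).
Implicit Types (A S : {set I}) (G : {set I} -> R).

(* The expectation of [G] at the set of occupied boxes after [n] independent
   draws of law [w], when the boxes in [A] are occupied at the start. *)
Fixpoint Edraw n (G : {set I} -> R) (A : {set I}) : R :=
  if n is m.+1 then \sum_x w x * Edraw m G (x |: A) else G A.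

Lemma eq_Edraw n (G G' : {set I} -> R) A :
  (forall S, A \subset S -> G S = G' S) -> Edraw n G A = Edraw n G' A.
Proof.
elim: n A => [|n IHn] A GG' /=; first exact: GG'.
apply: eq_bigr => x _; congr (_ * _); apply: IHn => S AS.
by apply: GG'; exact: subset_trans (subsetUr _ _) AS.
Qed.

Lemma EdrawD n G G' A :
  Edraw n (fun S => G S + G' S) A = Edraw n G A + Edraw n G' A.
Proof.
elim: n A => [//|n IHn] A /=.
by rewrite -big_split; apply: eq_bigr => x _; rewrite IHn mulrDr.
Qed.

Lemma EdrawZ n c G A : Edraw n (fun S => c * G S) A = c * Edraw n G A.
Proof.
elim: n A => [//|n IHn] A /=.
by rewrite mulr_sumr; apply: eq_bigr => x _; rewrite IHn mulrCA.
Qed.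

Lemma EdrawB n G G' A :
  Edraw n (fun S => G S - G' S) A = Edraw n G A - Edraw n G' A.
Proof.
rewrite -mulN1r -EdrawZ -EdrawD.
by apply: eq_Edraw => S _; rewrite mulN1r.
Qed.

Lemma Edraw_sum n (J : finType) (G : J -> {set I} -> R) A :
  Edraw n (fun S => \sum_j G j S) A = \sum_j Edraw n (G j) A.
Proof.
elim: n A => [//|n IHn] A /=; rewrite exchange_big /=.
by apply: eq_bigr => x _; rewrite IHn mulr_sumr.
Qed.

Lemma EdrawU n G B A : Edraw n G (B :|: A) = Edraw n (fun S => G (B :|: S)) A.
Proof.
elim: n A => [//|n IHn] A /=.
by apply: eq_bigr => x _; rewrite setUCA IHn.
Qed.

Hypothesis w_ge0 : forall x, 0 <= w x.

Lemma le_Edraw n (G G' : {set I} -> R) A :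
  (forall S, A \subset S -> G S <= G' S) -> Edraw n G A <= Edraw n G' A.
Proof.
elim: n A => [|n IHn] A GG' /=; first exact: GG'.
apply: ler_sum => x _; apply: ler_wpM2l => //; apply: IHn => S AS.
by apply: GG'; exact: subset_trans (subsetUr _ _) AS.
Qed.

Lemma ler_norm_Edraw n G A :
  `|Edraw n G A| <= Edraw n (fun S => `|G S|) A.
Proof.
rewrite ler_norml lerNl -mulN1r -EdrawZ !le_Edraw// => S _.
  exact: ler_norm.
by rewrite mulN1r lerNl lerNnormlW.
Qed.

Hypothesis w_sum : \sum_x w x = 1.

Lemma w_le1 x : w x <= 1.
Proof.
by rewrite -w_sum (bigD1 x)//= lerDl sumr_ge0.
Qed.

Lemma sum_wC i : \sum_(x | x != i) w x = 1 - w i.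
Proof. by rewrite -w_sum [in RHS](bigD1 i)//= addrAC subrr add0r. Qed.

Lemma Edraw_cst n c A : Edraw n (fun=> c) A = c.
Proof.
elim: n A => [//|n IHn] A /=.
by under eq_bigr do rewrite IHn; rewrite -mulr_suml w_sum mul1r.
Qed.

Lemma Edraw_avoid n j (A : {set I}) : j \notin A ->
  Edraw n (fun S => (j \notin S)%:R) A = (1 - w j) ^+ n.
Proof.
elim: n A => [|n IHn] A jA /=; first by rewrite jA.
rewrite (bigD1 j)//= (@eq_Edraw _ _ (fun=> 0)); last first.
  by move=> S /subsetP/(_ j); rewrite setU11 => ->.
rewrite Edraw_cst mulr0 add0r.
rewrite (eq_bigr (fun x => w x * (1 - w j) ^+ n)) => [|x xj]; last first.
  by rewrite IHn// !inE (negbTE jA) orbF eq_sym.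
by rewrite -mulr_suml sum_wC exprS.
Qed.

(** Once a draw has hit [x], adding [x] to the occupied set changes nothing. The difference
    therefore lives on the event that all draws avoid [x], where it is at most [L]. *)
Lemma Edraw_add1 n G L x (A : {set I}) :
  (forall S, `|G (x |: S) - G S| <= L) -> x \notin A ->
  `|Edraw n G (x |: A) - Edraw n G A| <= L * (1 - w x) ^+ n.
Proof.
move=> GL xA; rewrite EdrawU -EdrawB -(@Edraw_avoid n x A)// -EdrawZ.
apply: le_trans (ler_norm_Edraw _ _ _) _; apply: le_Edraw => S _.
case: (boolP (x \in S)) => [xS|xS]; last by rewrite mulr1.
by rewrite mulr0 (setUidPr _) ?sub1set// subrr normr0.
Qed.

Definition newmass n i (A : {set I}) : R :=
  \sum_(j | (j \notin A) && (j != i)) w j * (1 - w j) ^+ n.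

(* [newmass n i A] is the probability that the draw following [n] others shows
   a value other than [i] which is neither in [A] nor among those [n]. *)
Lemma sum_newmass n i (A : {set I}) :
  \sum_(x | x != i) w x * newmass n i (x |: A) <=
  (1 - w i) * newmass n.+1 i A.
Proof.
rewrite /newmass; under eq_bigr do rewrite mulr_sumr big_mkcond /=.
rewrite exchange_big /= mulr_sumr [leRHS]big_mkcond/=; apply: ler_sum => j _.
case: ifP => [/andP[jA ji]|/negbT]; last first.
  rewrite negb_and !negbK => jA; rewrite big1// => x _.
  by rewrite !inE negb_or -andbA; case/orP: jA => ->; rewrite /= ?andbF.
rewrite (eq_bigr (fun x => (if x != j then w x else 0) * (w j * (1 - w j) ^+ n))).
  rewrite -mulr_suml -big_mkcondr /=; set c := w j * (1 - w j) ^+ n.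
  rewrite (_ : (1 - w i) * (w j * _) = (1 - w i) * (1 - w j) * c); last first.
    by rewrite /c exprS; ring.
  apply: ler_wpM2r; first by rewrite mulr_ge0// exprn_ge0// subr_ge0 w_le1.
  (* The factor [1 - w i - w j] falls short of [(1 - w i) * (1 - w j)] by [w i * w j], which is the
     only loss. *)
  have -> : \sum_(x | (x != i) && (x != j)) w x = 1 - w i - w j.
    by rewrite -(sum_wC i) [in RHS](bigD1 j)//= addrAC subrr add0r.
  by have := mulr_ge0 (w_ge0 i) (w_ge0 j); nra.
move=> x xi; rewrite !inE negb_or jA ji !andbT eq_sym.
by case: ifP => _; rewrite ?mul0r.
Qed.

(* For the induction: forbidding box [i] in the first draw only matters, with
   weight [w i], if that draw is the only one to occupy its box. *)
Lemma Edraw_condition n G L i (A : {set I}) :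
    (forall S, G (i |: S) = G S) ->
    (forall x S, `|G (x |: S) - G S| <= L) -> i \notin A ->
  `|Edraw n (fun S => (i \notin S)%:R * G S) A - (1 - w i) ^+ n * Edraw n G A|
  <= L * n%:R * w i * (1 - w i) ^+ n.-1 * newmass n.-1 i A.
Proof.
move=> Gi GL; elim: n A => [|n IHn] A iA /=.
  by rewrite iA !mul1r subrr normr0 mulr0 !mul0r.
have q0 : 0 <= 1 - w i by rewrite subr_ge0 w_le1.
have L0 : 0 <= L by apply: le_trans (GL i A).
set H := fun x => Edraw n G (x |: A).
have Hi : H i = Edraw n G A.
  by rewrite /H EdrawU; apply: eq_Edraw => S _; rewrite Gi.
rewrite (bigD1 i)//= (@eq_Edraw _ _ (fun=> 0)); last first.
  by move=> S /subsetP/(_ i); rewrite setU11 => ->//; rewrite mul0r.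
rewrite Edraw_cst mulr0 add0r.
(* The first sum lets the first draw avoid [i] and feeds the induction. The second is the
   correction: it compares a first draw [x] with the draw [i], which [G] does not see. *)
have -> : (1 - w i) ^+ n.+1 * (\sum_x w x * Edraw n G (x |: A)) =
   (\sum_(x | x != i) w x * ((1 - w i) ^+ n * H x)) -
   (1 - w i) ^+ n * w i * \sum_(x | x != i) w x * (H x - H i).
  have -> : \sum_(x | x != i) w x * (H x - H i) =
      \sum_(x | x != i) w x * H x - (1 - w i) * H i.
    by under eq_bigr do rewrite mulrBr; rewrite sumrB -mulr_suml sum_wC.
  under [in RHS]eq_bigr do rewrite mulrCA.
  by rewrite -mulr_sumr (bigD1 i)//= -/(H i) exprS; ring.
rewrite opprB addrCA -sumrB.
rewrite [X in `|_ + X|](_ : _ = \sum_(x | x != i) w x *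
    (Edraw n (fun S => (i \notin S)%:R * G S) (x |: A) - (1 - w i) ^+ n * H x));
  last by apply: eq_bigr => x _; rewrite mulrBr.
apply: (le_trans (ler_normD _ _)).
have step1 : `|\sum_(x | x != i) w x *
      (Edraw n (fun S => (i \notin S)%:R * G S) (x |: A) - (1 - w i) ^+ n * H x)|
    <= L * n%:R * w i * (1 - w i) ^+ n * newmass n i A.
  apply: (le_trans (ler_norm_sum _ _ _)).
  (* For [n = 0] the predecessor in the bound is truncated, but both sides then vanish. *)
  case: n IHn @H Hi => [|n] IHn H Hi.
    rewrite mulr0 !mul0r big1// => x xi /=.
    by rewrite /H !inE eq_sym (negbTE xi) (negbTE iA) /= !mul1r subrr mulr0 normr0.
  apply: (@le_trans _ _ (\sum_(x | x != i) w x *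
     (L * n.+1%:R * w i * (1 - w i) ^+ n * newmass n i (x |: A)))).
    apply: ler_sum => x xi; rewrite normrM ger0_norm//; apply: ler_wpM2l => //.
    by apply: IHn; rewrite !inE negb_or eq_sym xi.
  under eq_bigr do rewrite mulrCA.
  rewrite -mulr_sumr; set c := L * n.+1%:R * w i * (1 - w i) ^+ n.
  rewrite (_ : L * n.+1%:R * w i * (1 - w i) ^+ n.+1 * _ =
      c * ((1 - w i) * newmass n.+1 i A)); last by rewrite /c exprS; ring.
  by apply: ler_wpM2l; [rewrite !mulr_ge0 ?exprn_ge0|exact: sum_newmass].
(* A first draw [x] differs from the draw [i] only if [x] is new and the later draws avoid it;
   summed over [x], these events have weight [newmass n i A]. *)
have step2 : `|(1 - w i) ^+ n * w i * \sum_(x | x != i) w x * (H x - H i)|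
    <= L * w i * (1 - w i) ^+ n * newmass n i A.
  rewrite normrM ger0_norm ?mulr_ge0 ?exprn_ge0//.
  rewrite (_ : _ * newmass n i A = (1 - w i) ^+ n * w i * (L * newmass n i A)); last ring.
  apply: ler_wpM2l; first by rewrite mulr_ge0 ?exprn_ge0.
  apply: (le_trans (ler_norm_sum _ _ _)).
  rewrite mulr_sumr [leRHS]big_mkcond [leLHS]big_mkcond; apply: ler_sum => x _.
  have [xi|xi] := eqVneq x i; first by rewrite andbF.
  rewrite andbT normrM ger0_norm// Hi; case: (boolP (x \in A)) => xA /=.
    by rewrite /H (setUidPr _) ?sub1set// subrr normr0 mulr0.
  by rewrite mulrCA; apply: ler_wpM2l => //; apply: Edraw_add1.
rewrite -natr1; apply: (le_trans (lerD step2 step1)).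
by rewrite le_eqVlt; apply/orP; left; apply/eqP; ring.
Qed.

Definition avoid_prob n i := (1 - w i) ^+ n.
Definition mean_card n := \sum_i (1 - avoid_prob n i).
(** The variance that the number of occupied boxes would have if the boxes were occupied
    independently of each other. *)
Definition var_proxy n := \sum_i avoid_prob n i * (1 - avoid_prob n i).
Definition hit_once n := \sum_i w i * (1 - w i) ^+ n.-1.

Lemma avoid_prob_ge0 n i : 0 <= avoid_prob n i.
Proof. by rewrite exprn_ge0// subr_ge0 w_le1. Qed.

Lemma avoid_prob_le1 n i : avoid_prob n i <= 1.
Proof. by rewrite exprn_ile1// ?subr_ge0 ?w_le1// gerBl. Qed.

Lemma var_proxy_ge0 n : 0 <= var_proxy n.
Proof.
by apply: sumr_ge0 => i _; rewrite mulr_ge0 ?subr_ge0 ?avoid_prob_ge0 ?avoid_prob_le1.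
Qed.

Lemma newmass_hit_once n i (A : {set I}) : newmass n.-1 i A <= hit_once n.
Proof.
rewrite /newmass big_mkcond; apply: ler_sum => j _; case: ifP => // _.
by rewrite mulr_ge0// exprn_ge0// subr_ge0 w_le1.
Qed.

Lemma natr_card (S : {set I}) : #|S|%:R = \sum_i (i \in S)%:R :> R.
Proof. by rewrite -sum1_card natr_sum big_mkcond; apply: eq_bigr => i _; case: ifP. Qed.

(** * Approximate Stein identity for the number of occupied boxes *)

Section card_stein.
Variables (n : nat) (f : nat -> R) (L : R).
Hypothesis f_lip : forall k, `|f k.+1 - f k| <= L.

Let add1_card i x (S : {set I}) (g : nat -> R) :
  (forall k, `|g k.+1 - g k| <= L) -> `|g #|(x |: S) :\ i| - g #|S :\ i| | <= L.
Proof.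
move=> gL; have L0 : 0 <= L by apply: le_trans (gL 0).
have [<-|xi] := eqVneq x i.
  by rewrite setDUl setDv set0U subrr normr0.
have -> : (x |: S) :\ i = x |: (S :\ i).
  apply/setP => y; rewrite !inE.
  by have [->|_] := eqVneq y x; rewrite ?xi.
rewrite cardsU1; case: (_ \in _) => /=; first by rewrite subrr normr0.
by rewrite add1n.
Qed.

Let condition_card i (g : nat -> R) : (forall k, `|g k.+1 - g k| <= L) ->
  `|Edraw n (fun S => (i \notin S)%:R * g #|S :\ i|) set0 -
    avoid_prob n i * Edraw n (fun S => g #|S :\ i|) set0|
  <= L * n%:R * (w i * (1 - w i) ^+ n.-1) * hit_once n.
Proof.
move=> gL; have L0 : 0 <= L by apply: le_trans (gL 0).
apply: le_trans (_ : L * n%:R * w i * (1 - w i) ^+ n.-1 * newmass n.-1 i set0 <= _).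
  apply: (@Edraw_condition n (fun S => g #|S :\ i|)); last by rewrite inE.
    by move=> S; rewrite setDUl setDv set0U.
  by move=> x S; apply: add1_card.
rewrite !mulrA; apply: ler_wpM2l (newmass_hit_once _ _ _).
by rewrite !mulr_ge0// exprn_ge0// subr_ge0 w_le1.
Qed.

(** The centred count is the sum over [i] of the centred indicators that box [i] is occupied.
    Splitting [f #|S|] according to that indicator and decoupling it from [#|S :\ i|] leaves the
    increment of [f] with weight [q * (1 - q)]. The decoupling errors, for [f] and for its shift,
    enter with weights [1 - q] and [q], so each box costs one error; summing over boxes produces the
    second factor [hit_once n]. *)
Lemma card_stein :
  `|Edraw n (fun S => (#|S|%:R - mean_card n) * f #|S|) set0 -
    \sum_i avoid_prob n i * (1 - avoid_prob n i) *
      Edraw n (fun S => f #|S :\ i|.+1 - f #|S :\ i|) set0|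
  <= L * n%:R * hit_once n ^+ 2.
Proof.
rewrite (_ : Edraw _ _ _ = \sum_i
    (Edraw n (fun S => (i \in S)%:R * f #|S|) set0 -
     (1 - avoid_prob n i) * Edraw n (fun S => f #|S|) set0)); last first.
  rewrite sumrB -mulr_suml -Edraw_sum -EdrawZ -EdrawB.
  by apply: eq_Edraw => S _; rewrite natr_card mulrBl !mulr_suml -sumrB.
rewrite -sumrB; apply: (le_trans (ler_norm_sum _ _ _)).
rewrite exprS expr1 {1}/hit_once mulr_suml mulr_sumr; apply: ler_sum => i _.
have E1 : Edraw n (fun S => (i \in S)%:R * f #|S|) set0 =
    Edraw n (fun S => f #|S :\ i|.+1) set0 -
    Edraw n (fun S => (i \notin S)%:R * f #|S :\ i|.+1) set0.
  rewrite -EdrawB; apply: eq_Edraw => S _; rewrite (cardsD1 i S).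
  by case: (i \in S) => /=; rewrite ?add1n ?mul1r ?mul0r ?subr0 ?subrr.
have E2 : Edraw n (fun S => f #|S|) set0 =
    Edraw n (fun S => (i \in S)%:R * f #|S|) set0 +
    Edraw n (fun S => (i \notin S)%:R * f #|S :\ i|) set0.
  rewrite -EdrawD; apply: eq_Edraw => S _; rewrite (cardsD1 i S).
  by case: (i \in S) => /=; rewrite ?add1n ?add0n ?mul1r ?mul0r ?addr0 ?add0r.
rewrite E2 E1 EdrawB.
have := @condition_card i f f_lip.
have /= := @condition_card i (fun k => f k.+1) (fun k => f_lip k.+1).
have := avoid_prob_ge0 n i; have := avoid_prob_le1 n i.
set a := Edraw n (fun S => f #|S :\ i|.+1) set0.
set b := Edraw n (fun S => f #|S :\ i|) set0.
set ca := Edraw n (fun S => _ * f #|S :\ i|.+1) set0.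
set cb := Edraw n (fun S => _ * f #|S :\ i|) set0.
set q := avoid_prob n i; set B := _ * hit_once n => q1 q0 hA hB.
rewrite [leRHS](_ : _ = B); last by rewrite /B; ring.
rewrite (_ : _ - _ = - (q * (ca - q * a) + (1 - q) * (cb - q * b))); last by ring.
rewrite normrN (le_trans (ler_normD _ _))// !normrM ger0_norm// (@ger0_norm _ (1 - q)) ?subr_ge0//.
have -> : B = q * B + (1 - q) * B by ring.
by apply: lerD; apply: ler_wpM2l; rewrite ?subr_ge0.
Qed.

End card_stein.

Definition stdz (m s : R) (k : nat) : R := (k%:R - m) / s.

(** Apply [card_stein] to [F] composed with the standardization, whose increments are at most
    [C / s]. The four terms come, in order, from the centring by [m], from the scaling by [s], from
    replacing increments by derivatives, and from the decoupling error. *)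
Lemma stein_bound n (F dF : R -> R) (C m s : R) : 0 < s ->
    (forall x, `|F x| <= C) -> (forall x, `|dF x| <= C) ->
    (forall x y, `|F x - F y| <= C * `|x - y|) ->
    (forall x y, `|F x - F y - dF y * (x - y)| <= C * (x - y) ^+ 2) ->
  `|Edraw n (fun S => stdz m s #|S| * F (stdz m s #|S|) - dF (stdz m s #|S|))
      set0| <=
  C * (`|mean_card n - m| / s + `|var_proxy n - s ^+ 2| / s ^+ 2 +
       var_proxy n / s ^+ 3 + n%:R * hit_once n ^+ 2 / s ^+ 2).
Proof.
move=> s0 FC dFC FL FT; pose Wk := stdz m s; pose W (S : {set I}) := Wk #|S|.
have C0 : 0 <= C by apply: le_trans (FC 0).
have sn0 : s != 0 by rewrite gt_eqF.
pose f k := F (Wk k).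
have WkS k : Wk k.+1 - Wk k = s^-1.
  by rewrite /Wk /stdz -mulrBl -natr1 opprB addrA subrK addrAC subrr add0r mul1r.
have f_lip k : `|f k.+1 - f k| <= C / s.
  by apply: le_trans (FL _ _) _; rewrite WkS ger0_norm// invr_ge0 ltW.
have := card_stein n f_lip.
set X := Edraw n _ set0; set Y := \sum_i _ => XY.
set D := Edraw n (fun S => dF (W S)) set0.
have dY : `|Y - var_proxy n / s * D| <= var_proxy n * (C / s ^+ 2).
  rewrite /Y /D /var_proxy !mulr_suml -sumrB.
  apply: (le_trans (ler_norm_sum _ _ _)); apply: ler_sum => i _.
  set c := avoid_prob n i * _.
  have c0 : 0 <= c.
    by rewrite mulr_ge0 ?subr_ge0 ?avoid_prob_ge0 ?avoid_prob_le1.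
  rewrite -mulrA -mulrBr normrM ger0_norm//; apply: ler_wpM2l => //.
  rewrite -EdrawZ -EdrawB; apply: (le_trans (ler_norm_Edraw _ _ _)).
  rewrite -[leRHS](Edraw_cst n (C / s ^+ 2) set0); apply: le_Edraw => S _.
  rewrite /W (cardsD1 i S); set k := #|S :\ i|.
  (* The increment runs from [k] to [k.+1], whereas [dF] is taken at the actual count, which is
     [k.+1] or [k] according to box [i]. The Taylor bound is applied at the matching end. *)
  case: (i \in S) => /=; rewrite ?add1n ?add0n.
    have := FT (Wk k) (Wk k.+1); rewrite -(opprB (Wk k.+1)) WkS sqrrN exprVn.
    rewrite mulrN opprK; apply: le_trans; rewrite -normrN /f.
    by rewrite le_eqVlt; apply/orP; left; apply/eqP; congr `|_|; ring.
  by have := FT (Wk k.+1) (Wk k); rewrite WkS exprVn mulrC.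
have ED : `|D| <= C.
  apply: (le_trans (ler_norm_Edraw _ _ _)).
  by rewrite -[leRHS](Edraw_cst n C set0); apply: le_Edraw.
set Ef := Edraw n (fun S => f #|S|) set0.
have Ef_le : `|Ef| <= C.
  apply: (le_trans (ler_norm_Edraw _ _ _)).
  by rewrite -[leRHS](Edraw_cst n C set0); apply: le_Edraw => S _; exact: FC.
rewrite (_ : Edraw _ _ _ = (X - Y) / s + (mean_card n - m) / s * Ef +
    (Y - var_proxy n / s * D) / s + (var_proxy n - s ^+ 2) / s ^+ 2 * D); last first.
  have -> : (X - Y) / s + (mean_card n - m) / s * Ef +
     (Y - var_proxy n / s * D) / s + (var_proxy n - s ^+ 2) / s ^+ 2 * D =
     s^-1 * X + (mean_card n - m) / s * Ef - D by field.
  rewrite /X /Ef /D -!EdrawZ -EdrawD -EdrawB; apply: eq_Edraw => S _.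
  by rewrite /W /f /Wk /stdz; field.
set v := var_proxy n in dY *; set h := n%:R * _ ^+ 2.
have v0 : 0 <= v := var_proxy_ge0 n.
rewrite (_ : C * _ = C / s * n%:R * hit_once n ^+ 2 / s + `|mean_card n - m| / s * C +
  v * (C / s ^+ 2) / s + `|v - s ^+ 2| / s ^+ 2 * C); last by rewrite /h; field.
have sV : 0 <= s^-1 by rewrite invr_ge0 ltW.
have sV2 : 0 <= (s ^+ 2)^-1 by rewrite invr_ge0 exprn_ge0// ltW.
apply: (le_trans (ler_normD _ _)); apply: lerD.
  apply: (le_trans (ler_normD _ _)); apply: lerD.
    apply: (le_trans (ler_normD _ _)); apply: lerD.
      by rewrite normrM (ger0_norm sV) ler_wpM2r.
    rewrite !normrM (ger0_norm sV); apply: ler_pM => //.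
    by rewrite mulr_ge0.
  by rewrite normrM (ger0_norm sV) ler_wpM2r.
by rewrite !normrM (ger0_norm sV2); apply: ler_pM => //; rewrite mulr_ge0.
Qed.

(** Exactly one success in [n] trials is less likely than at least one. Algebraically,
    [1 - (1 - x) ^+ n] is [x] times a geometric sum whose [n] terms are at least
    [(1 - x) ^+ n.-1]. *)
Lemma mean_hit_le (x : R) n : 0 <= x <= 1 ->
  n%:R * (x * (1 - x) ^+ n.-1) <= 1 - (1 - x) ^+ n.
Proof.
case/andP => x0 x1; case: n => [|n]; first by rewrite mul0r expr0 subrr.
have y0 : 0 <= 1 - x by rewrite subr_ge0.
have := subrXX 1 (1 - x) n.+1; rewrite expr1n => ->.
rewrite (_ : 1 - (1 - x) = x) ?[_%:R * _]mulrCA; last by ring.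
apply: ler_wpM2l => //=; rewrite mulr_natl -[X in _ *+ X]card_ord -sumr_const.
apply: ler_sum => i _; rewrite expr1n mul1r.
by apply: ler_wiXn2l => //; [rewrite gerBl|rewrite -ltnS].
Qed.

(* By Cauchy-Schwarz on the light boxes, i.e. those outside [K]. *)
Lemma hit_once_bound n (K : {set I}) : (0 < n)%N ->
    \sum_(i | i \notin K) w i <= 2^-1 ->
  n%:R * hit_once n ^+ 2 <=
  2 * #|K|%:R ^+ 2 / n%:R + 4 * (\sum_(i | i \notin K) w i) * var_proxy n.
Proof.
move=> n0 tau_half; set tau := \sum_(i | _) _ in tau_half *.
have nR : 0 < n%:R :> R by rewrite ltr0n.
pose a i := (1 - w i) ^+ n.-1.
have a0 i : 0 <= a i by rewrite exprn_ge0// subr_ge0 w_le1.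
rewrite /hit_once (bigID (mem K)) /=.
set A := \sum_(i in K) _; set B := \sum_(i | _) _.
(* A box of [K], however heavy, contributes at most [1 / n] to [hit_once n]. *)
have AK : A <= #|K|%:R / n%:R.
  rewrite mulr_natl -sumr_const; apply: ler_sum => i _.
  rewrite -(ler_pM2l nR) mulfV ?gt_eqF//.
  apply: le_trans (@mean_hit_le (w i) n _) _; first by rewrite w_ge0 w_le1.
  by rewrite gerBl avoid_prob_ge0.
have A0 : 0 <= A by apply: sumr_ge0 => i _; exact: mulr_ge0 (w_ge0 i) (a0 i).
have tau0 : 0 <= tau by apply: sumr_ge0.
have Bv : n%:R * (\sum_(i | i \notin K) w i * a i ^+ 2) <= 2 * var_proxy n.
  rewrite /var_proxy !mulr_sumr big_mkcond; apply: ler_sum => i _.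
  have q0 := avoid_prob_ge0 n i; have q1 := avoid_prob_le1 n i.
  case: ifP => iK; last by rewrite !mulr_ge0 ?subr_ge0.
  have wi : w i <= 2^-1.
    apply: le_trans tau_half; rewrite /tau (bigD1 i)//= lerDl.
    exact: sumr_ge0.
  have h := @mean_hit_le (w i) n; rewrite w_ge0 w_le1 in h.
  move: {h}(h isT); rewrite -/(a i) -/(avoid_prob n i) => h.
  (* Since a light box has mass at most one half, dropping one factor [1 - w i] costs at most a
     factor 2. *)
  have aq : a i <= 2 * avoid_prob n i.
    rewrite /avoid_prob -(prednK n0) exprS -/(a i); have := a0 i; nra.
  rewrite (_ : n%:R * _ = n%:R * (w i * a i) * a i); last by ring.
  rewrite (_ : 2 * (_ * _) = (1 - avoid_prob n i) * (2 * avoid_prob n i)); last by ring.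
  by apply: ler_pM => //; rewrite !mulr_ge0.
have CS : B ^+ 2 <= tau * \sum_(i | i \notin K) w i * a i ^+ 2.
  have [t0|t0] := eqVneq tau 0.
    rewrite t0 mul0r (_ : B = 0) ?expr0n//; apply: big1 => i iK.
    suff -> : w i = 0 by rewrite mul0r.
    by apply/eqP; move/eqP: t0; rewrite psumr_eq0// => /allP/(_ i (mem_index_enum i))/implyP; apply.
  (* Cauchy-Schwarz with weights [w i]: expanding this sum of squares gives [tau] times the desired
     difference, hence the separate case [tau = 0]. *)
  have : 0 <= \sum_(i | i \notin K) w i * (tau * a i - B) ^+ 2.
    by apply: sumr_ge0 => i _; rewrite mulr_ge0// sqr_ge0.
  rewrite (eq_bigr (fun i => tau ^+ 2 * (w i * a i ^+ 2) - 2 * tau * B * (w i * a i) +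
     B ^+ 2 * w i)) => [|i _]; last by ring.
  rewrite big_split sumrB /= -!mulr_sumr -/tau -/B.
  have -> : tau ^+ 2 * (\sum_(i | i \notin K) w i * a i ^+ 2) - 2 * tau * B * B +
    B ^+ 2 * tau = tau * (tau * (\sum_(i | i \notin K) w i * a i ^+ 2) - B ^+ 2) by ring.
  by rewrite pmulr_rge0 ?subr_ge0// lt_def t0.
set V := var_proxy n in Bv *; set Q := \sum_(i | _) _ in Bv CS.
have h1 : n%:R * B ^+ 2 <= 2 * tau * V.
  apply: le_trans (_ : tau * (n%:R * Q) <= _).
    by rewrite [leRHS]mulrCA; apply: ler_wpM2l => //; rewrite ler0n.
  by rewrite (_ : 2 * tau * V = tau * (2 * V)); [exact: ler_wpM2l|ring].
have h2 : n%:R * A ^+ 2 <= #|K|%:R ^+ 2 / n%:R.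
  rewrite ler_pdivlMr//; have -> : n%:R * A ^+ 2 * n%:R = (A * n%:R) ^+ 2 by ring.
  by apply: lerXn2r; rewrite ?nnegrE ?mulr_ge0// -?ler_pdivlMr.
have : n%:R * (A + B) ^+ 2 <= 2 * (n%:R * A ^+ 2) + 2 * (n%:R * B ^+ 2).
  have -> : 2 * (n%:R * A ^+ 2) + 2 * (n%:R * B ^+ 2) =
    n%:R * (A + B) ^+ 2 + n%:R * (A - B) ^+ 2 by ring.
  by rewrite lerDl mulr_ge0 ?sqr_ge0// ler0n.
move/le_trans; apply; rewrite -[2 * _ / _]mulrA; apply: lerD; lra.
Qed.

End occupied_set.

(** * Stein's equation for the normal law *)

Section stein_functions.
Variable R : realType.

(** Exactly the analytic input of [stein_bound], with one constant for all four bounds. The last one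
    is a first-order Taylor estimate that makes [dF] act as the derivative of [F]. *)
Definition stein_test (C : R) (F dF : R -> R) :=
  [/\ forall x, `|F x| <= C, forall x, `|dF x| <= C,
      forall x y, `|F x - F y| <= C * `|x - y| &
      forall x y, `|F x - F y - dF y * (x - y)| <= C * (x - y) ^+ 2].

Lemma mean_value (F dF : R -> R) (x y : R) :
  (forall x : R, is_derive x 1 F (dF x)) ->
  exists2 c, `|c - y| <= `|x - y| & F x - F y = dF c * (x - y).
Proof.
move=> HF.
have cF a b : {within `[a, b], continuous F}.
  by apply: derivable_within_continuous => z _; exact: ex_derive.
have [xy|yx|->] := ltgtP x y; last by exists y; rewrite !subrr ?normr0 ?mulr0.
- have [c /itvP cxy E] := MVT xy (fun z _ => HF z) (cF _ _).
  exists c; last by rewrite -opprB E -mulrN opprB.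
  by rewrite !ler0_norm ?subr_le0 ?cxy ?(ltW xy)// lerN2 lerD2r cxy.
- have [c /itvP cxy E] := MVT yx (fun z _ => HF z) (cF _ _).
  exists c => //.
  by rewrite !ger0_norm ?subr_ge0 ?cxy ?(ltW yx)// lerD2r cxy.
Qed.

Lemma stein_testP (C : R) (F dF : R -> R) :
    (forall x : R, is_derive x 1 F (dF x)) ->
    (forall x, `|F x| <= C) -> (forall x, `|dF x| <= C) ->
    (forall x y, `|dF x - dF y| <= C * `|x - y|) ->
  stein_test C F dF.
Proof.
move=> HF FC dFC dFL; split=> // x y.
  have [c _ ->] := mean_value x y HF.
  by rewrite normrM ler_wpM2r.
have [c cy ->] := mean_value x y HF.
have C0 : 0 <= C by apply: le_trans (FC 0).
rewrite -mulrBl normrM -(real_normK (num_real (x - y))) expr2 mulrA.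
apply: ler_wpM2r => //; apply: (le_trans (dFL _ _)).
exact: ler_wpM2l.
Qed.

Lemma stein_test_atan : stein_test 2 (@atan R) (fun x => (1 + x ^+ 2)^-1).
Proof.
have p0 (x : R) : 0 < 1 + x ^+ 2 by rewrite ltr_pwDl// sqr_ge0.
apply: stein_testP => [x|x|x y].
- have := atan_gtNpi2 x; have := atan_ltpi2 x; have := @pihalf_lt2 R.
  by rewrite ler_norml; lra.
- rewrite gtr0_norm ?invr_gt0//; apply: (@le_trans _ _ 1); last by rewrite ler1n.
  by rewrite invf_le1// lerDl sqr_ge0.
- have := p0 x; have := p0 y => y0 x0.
  have -> : (1 + x ^+ 2)^-1 - (1 + y ^+ 2)^-1 =
      (y - x) * ((x + y) / ((1 + x ^+ 2) * (1 + y ^+ 2))).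
    by field; rewrite !gt_eqF.
  rewrite normrM distrC mulrC; apply: ler_wpM2r => //.
  rewrite normrM normfV (gtr0_norm (mulr_gt0 x0 y0)).
  rewrite ler_pdivrMr ?mulr_gt0//.
  apply: (le_trans (ler_normD _ _)).
  have := sqr_ge0 (`|x| - 1); have := sqr_ge0 (`|y| - 1).
  rewrite -(real_normK (num_real x)) -(real_normK (num_real y)).
  have := normr_ge0 x; have := normr_ge0 y.
  set a := `|x|; set b := `|y|; nra.
Qed.

Lemma lipschitz_continuous (L : R) (u : R -> R) :
  (forall x y, `|u x - u y| <= L * `|x - y|) -> continuous u.
Proof.
move=> uL x; apply/cvgrPdist_lt => e e0.
have L1 : 0 < `|L| + 1 by rewrite ltr_wpDl.
near=> y.
apply: (le_lt_trans (uL _ _)); apply: (@le_lt_trans _ _ ((`|L| + 1) * `|x - y|)).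
  by apply: ler_wpM2r => //; rewrite ler_wpDr// ler_norm.
rewrite -ltr_pdivlMl//; near: y; apply: cvgr_dist_lt => //.
by rewrite mulr_gt0// invr_gt0.
Unshelve. all: by end_near. Qed.

Lemma bounded_of_support (K : R) (f : R -> R) : continuous f ->
  (forall x, K <= `|x| -> f x = 0) -> exists C, forall x, `|f x| <= C.
Proof.
move=> cf f0.
have cf' : {within `[- K, K], continuous f} by exact: continuous_subspaceT.
have /compact_bounded[M [_ fM]] := continuous_compact cf' (@segment_compact R (- K) K).
exists (`|M| + 1) => x.
have [Kx|xK] := leP K `|x|; first by rewrite f0// normr0 addr_ge0.
apply: (fM (`|M| + 1)); first by rewrite (le_lt_trans (ler_norm M))// ltrDl.
by exists x => //=; rewrite in_itv/= -ler_norml ltW.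
Qed.

Notation phi := (normal_pdf (0 : R) 1).
Notation leb := (@lebesgue_measure R).

Lemma normal_pdf_gt0 x : 0 < phi x.
Proof.
by rewrite normal_pdfE ?oner_neq0// mulr_gt0 ?normal_peak_gt0 ?oner_neq0 ?expR_gt0.
Qed.

Lemma is_derive_normal_pdf (x : R) : is_derive x 1 phi (- x * phi x).
Proof.
have -> : phi = fun y => normal_peak 1 * expR (- (2^-1 * y ^+ 2)).
  apply/funext => y; rewrite normal_pdfE ?oner_neq0// /normal_fun subr0 expr1n.
  by congr (_ * expR _); rewrite mulNr mulrC.
apply: is_derive_eq.
by rewrite /GRing.scale/= !mulr1; field.
Qed.

Lemma integrable_bounded_normal_pdf (u : R -> R) (C : R) (D : set R) :
    measurable D -> measurable_fun setT u -> (forall x, `|u x| <= C) ->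
  leb.-integrable D (EFin \o (fun x => u x * phi x)).
Proof.
move=> mD mu uC.
apply: (@integrableS _ _ _ leb setT) => //.
apply: (@le_integrable _ _ _ leb setT measurableT _ (fun x => C%:E * (phi x)%:E)%E).
- by apply/measurable_EFinP/measurable_funM => //; exact: measurable_normal_pdf.
- move=> x _ /=; rewrite lee_fin normrM [leRHS]normrM; apply: ler_wpM2r => //.
  by rewrite (le_trans (uC x))// ler_norm.
- by apply: integrableZl => //; exact: integrable_normal_pdf.
Qed.

(* [F] is the quotient by [phi] of the primitive of [u phi] vanishing at -oo; as
   the total integral is zero, [F] has compact support, so that no estimate of
   Gaussian tails is needed. *)
Lemma stein_solution (L C K : R) (u : R -> R) :
    (forall x y, `|u x - u y| <= L * `|x - y|) ->
    (forall x, `|u x| <= C) -> (forall x, K <= `|x| -> u x = 0) ->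
    \int[leb]_x (u x * phi x) = 0 ->
  exists C' F, stein_test C' F (fun x => x * F x + u x).
Proof.
move=> uL uC u0 Iu.
have cu := lipschitz_continuous uL.
have mu : measurable_fun setT u := continuous_measurable_fun cu.
pose g x := u x * phi x.
have ig D : measurable D -> leb.-integrable D (EFin \o g).
  by move=> mD; exact: integrable_bounded_normal_pdf mu uC.
pose G y := \int[leb]_(x in `]-oo, y]) g x.
have cg : continuous g.
  move=> x; apply: cvgM; first exact: cu.
  exact/continuous_normal_pdf/oner_neq0.
have dG (y : R) : is_derive y 1 G (g y).
  have y1 : y < y + 1 by rewrite ltrDl.
  have [|dG1 dG2] := @continuous_FTC1 R g -oo%O y (y + 1) y1 (ig _ (measurable_itv _)) _ (cg y).
    by rewrite ltNyr.
  by apply: DeriveDef => //; rewrite -derive1E.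
pose F y := (phi y)^-1 * G y.
have dF (y : R) : is_derive y 1 F (y * F y + u y).
  have dphi := is_derive_normal_pdf y.
  have phi0 : phi y != 0 by rewrite gt_eqF// normal_pdf_gt0.
  have dphiV := is_deriveV phi0 dphi.
  apply: is_derive_eq; rewrite /F /g /GRing.scale/=.
  by field.
have int0 (D : set R) : (forall x, D x -> K <= `|x|) -> \int[leb]_(x in D) g x = 0.
  move=> DK; rewrite /Rintegral integral0_eq// => x Dx.
  by rewrite /g u0 ?mul0r//; exact: DK.
have F0 y : K <= `|y| -> F y = 0.
  move=> Ky; rewrite /F; suff -> : G y = 0 by rewrite mulr0.
  have [y0|y0] := leP 0 y; last first.
    apply: int0 => x /=; rewrite in_itv/= => xy.
    by rewrite (le_trans Ky)// !ltr0_norm ?lerN2// (le_lt_trans xy).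
  (* To the right of the support, the integral up to [y] equals the total one, which is zero. *)
  have := Iu; rewrite -(itv_setU_setT false y) Rintegral_setU//=; last 2 first.
  - by rewrite itv_setU_setT; exact: ig.
  - exact: disjoint_rays.
  rewrite [X in _ + X](int0 `]y, +oo[%classic) ?addr0// => x /=.
  rewrite in_itv/= andbT => yx; rewrite (le_trans Ky)//.
  by rewrite !ger0_norm// ltW// (le_lt_trans y0).
have cF : continuous F by move=> y; apply: differentiable_continuous; apply/derivable1_diffP; case: (dF y).
have [C1 F1] := bounded_of_support cF F0.
pose F' y := y * F y + u y.
have cF' : continuous F'.
  by move=> y; apply: cvgD; [apply: cvgM; [exact: cvg_id|exact: cF]|exact: cu].
have [C2 F2] : exists C2, forall x, `|F' x| <= C2.
  by apply: (@bounded_of_support K) => // x Kx; rewrite /F' F0// u0// mulr0 addr0.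
(* This bound serves the Lipschitz estimate of [x * F x], whose derivative is [F x + x * F' x]. *)
have [C3 F3] : exists C3, forall x, `|x * F' x| <= C3.
  apply: (@bounded_of_support K) => // [x|x Kx].
    by apply: cvgM; [exact: cvg_id|exact: cF'].
  by rewrite /F' F0// u0// mulr0 addr0 mulr0.
have dxF (y : R) : is_derive y 1 (fun x => x * F x) (F y + y * F' y).
  have dFy := dF y.
  by apply: is_derive_eq; rewrite /GRing.scale/= mulr1 addrC.
have nonneg (f : R -> R) D : (forall x, `|f x| <= D) -> 0 <= D.
  by move=> /(_ 0); exact: le_trans.
have C10 := nonneg _ _ F1; have C20 := nonneg _ _ F2; have C30 := nonneg _ _ F3.
exists (C1 + C2 + C3 + `|L|), F; apply: stein_testP => // [x|x|x y].
- by apply: le_trans (F1 x) _; rewrite -!addrA lerDl !addr_ge0.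
- by apply: le_trans (F2 x) _; rewrite (addrC C1) -!addrA lerDl !addr_ge0.
rewrite (_ : _ - _ = (x * F x - y * F y) + (u x - u y)); last by ring.
apply: (le_trans (ler_normD _ _)); rewrite [leRHS]mulrDl; apply: lerD; last first.
  by apply: (le_trans (uL x y)); rewrite ler_wpM2r// ler_norm.
have [c _ ->] := mean_value x y dxF.
rewrite normrM ler_wpM2r// (le_trans (ler_normD _ _))// lerD//.
by rewrite (le_trans (F1 c))// lerDl.
Qed.
End stein_functions.

(** * Trapezoidal test functions and their Gaussian integrals *)

Section trapezoid.
Variable R : realType.
Implicit Types a b k x y : R.

(** For [k > 0] this vanishes outside []a, b[], has slopes [k] and [- k], and equals 1 at distance
    at least [1 / k] from both ends. It is Lipschitz with compact support, as [stein_solution]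
    demands, and approximates indicators of intervals from below. *)
Definition trapezoid a b k x : R :=
  Num.max 0 (Num.min 1 (k * Num.min (x - a) (b - x))).

Lemma trapezoid_ge0 a b k x : 0 <= trapezoid a b k x.
Proof. by rewrite le_max lexx. Qed.

Lemma trapezoid_le1 a b k x : trapezoid a b k x <= 1.
Proof. by rewrite ge_max ler01 ge_min lexx. Qed.

Lemma norm_trapezoid_le1 a b k x : `|trapezoid a b k x| <= 1.
Proof. by rewrite ger0_norm ?trapezoid_ge0 ?trapezoid_le1. Qed.

Lemma trapezoid_left a b k x : 0 <= k -> x <= a -> trapezoid a b k x = 0.
Proof.
move=> k0 xa; apply/max_idPl; rewrite ge_min; apply/orP; right.
by rewrite mulr_ge0_le0// ge_min subr_le0 xa.
Qed.

Lemma trapezoid_right a b k x : 0 <= k -> b <= x -> trapezoid a b k x = 0.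
Proof.
move=> k0 bx; apply/max_idPl; rewrite ge_min; apply/orP; right.
by rewrite mulr_ge0_le0// ge_min !subr_le0 bx orbT.
Qed.

Lemma trapezoid1 a b k x : 0 <= k -> 1 <= k * (x - a) -> 1 <= k * (b - x) ->
  trapezoid a b k x = 1.
Proof.
move=> k0 xa bx; rewrite /trapezoid (min_idPl _).
  by apply/max_idPr; exact: ler01.
by rewrite minr_pMr// le_min xa.
Qed.

Lemma trapezoid_support a b k x :
  0 <= k -> `|a| + `|b| <= `|x| -> trapezoid a b k x = 0.
Proof.
move=> k0; case: (ltP 0 x) => x0.
  rewrite (gtr0_norm x0) => abx; apply: trapezoid_right => //.
  by apply: (le_trans _ abx); rewrite (le_trans (ler_norm b))// lerDr.
rewrite (ler0_norm x0) => abx; apply: trapezoid_left => //.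
by have := lerNnormlW (lexx `|a|); have := normr_ge0 b; lra.
Qed.

Lemma lipschitz_min (p q r s c : R) :
  `|p - r| <= c -> `|q - s| <= c -> `|Num.min p q - Num.min r s| <= c.
Proof.
rewrite !ler_norml => /andP[? ?] /andP[? ?].
by case: (leP p q); case: (leP r s) => ? ?; apply/andP; split; lra.
Qed.

Lemma lipschitz_max (p q r s c : R) :
  `|p - r| <= c -> `|q - s| <= c -> `|Num.max p q - Num.max r s| <= c.
Proof.
rewrite !ler_norml => /andP[? ?] /andP[? ?].
by case: (leP p q); case: (leP r s) => ? ?; apply/andP; split; lra.
Qed.

Lemma lipschitz_trapezoid a b k x y : 0 <= k ->
  `|trapezoid a b k x - trapezoid a b k y| <= k * `|x - y|.
Proof.
move=> k0; have kxy : 0 <= k * `|x - y| by rewrite mulr_ge0.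
apply: lipschitz_max; first by rewrite subrr normr0.
apply: lipschitz_min; first by rewrite subrr normr0.
rewrite -mulrBr normrM ger0_norm//; apply: ler_wpM2l => //.
apply: lipschitz_min; first by rewrite opprB addrA subrK.
by rewrite (_ : b - x - (b - y) = y - x) ?(distrC y)//; ring.
Qed.

Lemma measurable_trapezoid a b k : 0 <= k -> measurable_fun setT (trapezoid a b k).
Proof.
move=> k0; apply: continuous_measurable_fun.
by apply: (@lipschitz_continuous R k) => x y; exact: lipschitz_trapezoid.
Qed.

Notation phi := (normal_pdf (0 : R) 1).
Notation leb := (@lebesgue_measure R).

Lemma cvg_integral_normal (h : nat -> R -> R) (A : set R) : measurable A ->
    (forall m, measurable_fun setT (h m)) -> (forall m x, `|h m x| <= 1) ->
    (forall x, \forall m \near \oo, h m x = \1_A x) ->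
  \int[leb]_x (h m x * phi x) @[m --> \oo] --> fine (normal_prob 0 1 A).
Proof.
move=> mA mh h1 hA.
apply: fine_cvg; rewrite fineK ?fin_num_measure//.
rewrite [X in _ --> X]integral_mkcond.
apply: (@dominated_cvg _ _ _ leb setT measurableT
  (fun m x => (h m x * phi x)%:E) _ (EFin \o phi)) => //.
- move=> k; apply/measurable_EFinP/measurable_funM; first exact: mh.
  exact: measurable_normal_pdf.
- move=> x _; apply: cvg_near_cst; near=> m.
  rewrite patchE; have -> : h m x = \1_A x by near: m; exact: hA.
  by rewrite indicE; case: ifP => _; rewrite ?mul1r ?mul0r.
- exact: integrable_normal_pdf.
- move=> k x _ /=; rewrite lee_fin normrM (ger0_norm (normal_pdf_ge0 _ _ _)).
  by rewrite ler_piMl// normal_pdf_ge0.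
Unshelve. all: by end_near. Qed.

End trapezoid.

(** * From Stein's equation to distribution functions *)

Section stein_portmanteau.
(** [La n] plays the part of the expectation under the n-th law, kept abstract as a normalized
    monotone linear functional that satisfies Stein's identity in the limit. *)
Variables (R : realType) (La : nat -> (R -> R) -> R).
Hypothesis LaB : forall n f g, La n (fun x => f x - g x) = La n f - La n g.
Hypothesis LaZ : forall n c f, La n (fun x => c * f x) = c * La n f.
Hypothesis La_le : forall n f g, (forall x, f x <= g x) -> La n f <= La n g.
Hypothesis La_cst : forall n c, La n (fun=> c) = c.
Hypothesis La_stein : forall C F dF, stein_test C F dF ->
  La n (fun x => x * F x - dF x) @[n --> \oo] --> 0.

Notation phi := (normal_pdf (0 : R) 1).
Notation leb := (@lebesgue_measure R).

(* The test function [atan] gives tightness. *)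
Lemma stein_tight (e : R) : 0 < e ->
  exists2 K : R, 0 < K & \forall n \near \oo, La n (fun x => (K <= `|x|)%R%:R) <= e.
Proof.
move=> e0; pose K := 1 + 4 / e; have e40 : 0 < 4 / e by rewrite divr_gt0.
exists K; first by rewrite addr_gt0.
near=> n.
have K1 : 1 <= K by rewrite lerDl ltW.
have pi2 := pi_ge2 R.
have atan_half : 2^-1 <= atan (1 : R) by rewrite atan1; lra.
(* Beyond [K], [x * atan x] is at least [K * atan 1], and [atan 1 = pi / 4] exceeds one half. As the
   limiting mean of [x * atan x] is at most 1, the tail is eventually at most [4 / K], whence the
   choice of [K]. *)
have xatan (x : R) : (K <= `|x|)%R%:R <= (2 / K) * (x * atan x).
  have -> : x * atan x = `|x| * atan `|x|.
    by case: (leP 0 x) => [x0|x0]; rewrite ?(ger0_norm x0) ?(ltr0_norm x0)// atanN mulrNN.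
  have [Kx|xK] := leP K `|x| => /=; last first.
    by rewrite !mulr_ge0 ?invr_ge0 ?(le_trans _ K1)// -(@atan0 R) le_atan.
  rewrite mulrAC ler_pdivlMr; last by rewrite (lt_le_trans _ K1).
  have : atan 1 <= atan `|x| by apply: le_atan; exact: le_trans Kx.
  nra.
have h : La n (fun x => (K <= `|x|)%R%:R) <=
   (2 / K) * (La n (fun x => x * atan x - (1 + x ^+ 2)^-1) + 1).
  have <- : La n (fun x => x * atan x - (1 + x ^+ 2)^-1 - -1) =
      La n (fun x => x * atan x - (1 + x ^+ 2)^-1) + 1 by rewrite LaB La_cst opprK.
  rewrite -LaZ.
  apply: La_le => x; apply: (le_trans (xatan x)); apply: ler_wpM2l.
    by rewrite divr_ge0// (le_trans _ K1).
  have : (1 + x ^+ 2)^-1 <= 1 by rewrite invf_le1 ?lerDl ?ltr_pwDl ?sqr_ge0.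
  lra.
apply: (le_trans h).
have : `|0 - La n (fun x => x * atan x - (1 + x ^+ 2)^-1)| <= 1.
  by near: n; move/cvgrPdist_le: (La_stein (stein_test_atan R)); apply.
rewrite sub0r normrN => /(le_trans (ler_norm _)) L1.
apply: (@le_trans _ _ (2 / K * 2)).
  by apply: ler_wpM2l; [rewrite divr_ge0// (le_trans _ K1)|lra].
rewrite mulrAC ler_pdivrMr; last by rewrite (lt_le_trans _ K1).
have -> : e * K = e + 4 by rewrite /K; field; rewrite gt_eqF.
lra.
Unshelve. all: by end_near. Qed.

(* Stein's equation is solved for the combination of [trapezoid a b k] and of a
   wide plateau [h0] that has zero Gaussian mean; tightness gives [h0] a mean
   close to 1. *)
Lemma stein_liminf (a b k e : R) : 0 <= k -> 0 < e ->
  \forall n \near \oo,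
    \int[leb]_x (trapezoid a b k x * phi x) - e <= La n (trapezoid a b k).
Proof.
move=> k0 e0; set h := trapezoid a b k.
have e20 : 0 < e / 2 by rewrite divr_gt0.
have [K K0 tK] := stein_tight e20.
pose h0 := trapezoid (- (K + 1)) (K + 1) 1.
have N01 a' b' k' : 0 <= k' ->
    0 <= \int[leb]_x (trapezoid a' b' k' x * phi x) <= 1.
  move=> k'0; apply/andP; split.
    by apply: Rintegral_ge0 => x _; rewrite mulr_ge0 ?trapezoid_ge0 ?normal_pdf_ge0.
  rewrite -[leRHS](_ : \int[leb]_x phi x = 1); last first.
    by rewrite /Rintegral integral_normal_pdf.
  apply: le_Rintegral => //.
  - apply: integrable_bounded_normal_pdf => //; first exact: measurable_trapezoid.
    by move=> x; exact: norm_trapezoid_le1.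
  - exact: integrable_normal_pdf.
  - by move=> x _; rewrite ler_piMl ?normal_pdf_ge0 ?trapezoid_le1.
have /andP[Nh_ge0 Nh_le1] := N01 a b k k0.
have /andP[Nh0_ge0 Nh0_le1] := N01 (- (K + 1)) (K + 1) 1 ler01.
set Nh := Rintegral _ _ _ in Nh_ge0 Nh_le1 *.
set Nh0 := Rintegral _ _ _ in Nh0_ge0 Nh0_le1.
pose u x := Nh0 * h x - Nh * h0 x.
have Iu : \int[leb]_x (u x * phi x) = 0.
  have ih a' b' k' : 0 <= k' ->
      leb.-integrable setT (EFin \o (fun x => trapezoid a' b' k' x * phi x)).
    move=> k'0; apply: integrable_bounded_normal_pdf => //.
      exact: measurable_trapezoid.
    by move=> x; exact: norm_trapezoid_le1.
  rewrite /u; under eq_Rintegral do rewrite mulrBl -!mulrA.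
  rewrite RintegralB//; last 2 first.
  - exact: (integrableZl measurableT Nh0 (ih _ _ _ k0)).
  - exact: (integrableZl measurableT Nh (ih _ _ _ ler01)).
  rewrite !RintegralZl//; last 2 first.
  - exact: ih.
  - exact: ih.
  by rewrite -/Nh -/Nh0 mulrC subrr.
have [C [F FT]] : exists C F, stein_test C F (fun x => x * F x + u x).
  apply: (@stein_solution _ (Nh0 * k + Nh * 1) (Nh0 + Nh)
    (`|a| + `|b| + (`|- (K + 1)| + `|K + 1|))) => //.
  - move=> x y; rewrite /u (_ : _ - _ = Nh0 * (h x - h y) - Nh * (h0 x - h0 y)); last by ring.
    rewrite (le_trans (ler_normB _ _))// mulrDl -!mulrA !normrM (ger0_norm Nh_ge0) (ger0_norm Nh0_ge0).
    by apply: lerD; apply: ler_wpM2l => //; apply: lipschitz_trapezoid.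
  - move=> x; rewrite (le_trans (ler_normB _ _))// !normrM !ger0_norm ?trapezoid_ge0//.
    by apply: lerD; rewrite ler_piMr// trapezoid_le1.
  - move=> x Kx; rewrite /u /h /h0 !trapezoid_support ?mulr0 ?subrr//.
      by apply: le_trans Kx; rewrite lerDr addr_ge0.
    by apply: le_trans Kx; rewrite lerDl addr_ge0.
have cu := La_stein FT.
near=> n.
have Lau : `|La n u| <= e / 2.
  have -> : La n u = - La n (fun x => x * F x - (x * F x + u x)).
    rewrite -mulN1r -LaZ; congr La; apply/funext => x; ring.
  rewrite -sub0r; near: n; move/cvgrPdist_le: cu; exact.
have La1 : 1 - e / 2 <= La n h0.
  apply: (@le_trans _ _ (1 - La n (fun x => (K <= `|x|)%R%:R))).
    by rewrite lerD2l lerN2; near: n.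
  rewrite -[X in X - _](La_cst n) -LaB; apply: La_le => x.
  case: (leP K `|x|) => [_|xK]; first by rewrite subrr trapezoid_ge0.
  rewrite subr0 /h0 trapezoid1//; move: (ltW xK); rewrite ler_norml => /andP[]; lra.
have Lah : 0 <= La n h by rewrite -(La_cst n 0); apply: La_le => x; exact: trapezoid_ge0.
(* With [Nh0 <= 1] and [Nh <= 1]: [La n h >= Nh0 * La n h >= Nh * La n h0 - e / 2 >= Nh - e]. *)
move: Lau; rewrite /u LaB !LaZ ler_norml => /andP[Lau _].
nra.
Unshelve. all: by end_near. Qed.

(** Trapezoids on [[-k, x]] lie below the indicator of the half-line and converge to that of its
    interior. One [k] that loses at most [e / 2] of Gaussian mass is fixed before [n] grows. *)
Lemma stein_le (x e : R) : 0 < e ->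
  \forall n \near \oo,
    fine (normal_prob 0 1 `]-oo, x[) - e <= La n (fun y => (y <= x)%R%:R).
Proof.
move=> e0; have e20 : 0 < e / 2 by rewrite divr_gt0.
pose h (k : nat) := trapezoid (- k%:R) x k%:R.
have : \int[leb]_y (h k y * phi y) @[k --> \oo] --> fine (normal_prob 0 1 `]-oo, x[).
  apply: cvg_integral_normal => //.
  - by move=> k; exact: measurable_trapezoid.
  - by move=> k y; exact: norm_trapezoid_le1.
  move=> y; rewrite indicE; have [yx|xy] := ltP y x; last first.
    apply: nearW => k; rewrite memNset/=; last by rewrite in_itv/= ltNge xy.
    exact: trapezoid_right.
  near=> k; rewrite mem_set/= ?in_itv//.
  apply: trapezoid1 => //; last first.
    by rewrite -ler_pdivrMr ?subr_gt0//; near: k; exact: nbhs_infty_ger.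
  have k1 : 1 <= k%:R :> R by near: k; exact: nbhs_infty_ger.
  have ky : 1 - y <= k%:R by near: k; exact: nbhs_infty_ger.
  nra.
move/cvgrPdist_le/(_ _ e20) => [k _ /(_ k (leqnn k))/=].
rewrite ler_norml => /andP[_ hk].
have := @stein_liminf (- k%:R) x k%:R _ (ler0n _ _) e20.
apply: filterS => n hn.
apply: (@le_trans _ _ (La n (h k))); first by rewrite /h; lra.
apply: La_le => y; have [yx|xy] := leP y x; first exact: trapezoid_le1.
by rewrite /h trapezoid_right// ltW.
Unshelve. all: by end_near. Qed.

(** Mirror image of [stein_le]. Lower bounds for a half-line and for its complement together enclose
    the distribution function. *)
Lemma stein_gt (x e : R) : 0 < e ->
  \forall n \near \oo,
    fine (normal_prob 0 1 `]x, +oo[) - e <= La n (fun y => (x < y)%R%:R).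
Proof.
move=> e0; have e20 : 0 < e / 2 by rewrite divr_gt0.
pose h (k : nat) := trapezoid x k%:R k%:R.
have : \int[leb]_y (h k y * phi y) @[k --> \oo] --> fine (normal_prob 0 1 `]x, +oo[).
  apply: cvg_integral_normal => //.
  - by move=> k; exact: measurable_trapezoid.
  - by move=> k y; exact: norm_trapezoid_le1.
  move=> y; rewrite indicE; have [xy|yx] := ltP x y; last first.
    apply: nearW => k; rewrite memNset/=; last by rewrite in_itv/= andbT ltNge yx.
    exact: trapezoid_left.
  near=> k; rewrite mem_set/= ?in_itv/= ?andbT//.
  apply: trapezoid1 => //.
    by rewrite -ler_pdivrMr ?subr_gt0//; near: k; exact: nbhs_infty_ger.
  have k1 : 1 <= k%:R :> R by near: k; exact: nbhs_infty_ger.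
  have ky : 1 + y <= k%:R by near: k; exact: nbhs_infty_ger.
  nra.
move/cvgrPdist_le/(_ _ e20) => [k _ /(_ k (leqnn k))/=].
rewrite ler_norml => /andP[_ hk].
have := @stein_liminf x k%:R k%:R _ (ler0n _ _) e20.
apply: filterS => n hn.
apply: (@le_trans _ _ (La n (h k))); first by rewrite /h; lra.
apply: La_le => y; have [xy|yx] := ltP x y; first exact: trapezoid_le1.
by rewrite /h trapezoid_left.
Unshelve. all: by end_near. Qed.

End stein_portmanteau.

(** * Reduction to finitely many boxes *)

Lemma measure_partition d (T : measurableType d) (R : realType)
    (P : {measure set T -> \bar R}) (I : finType) (g : T -> I) (A : set T) :
    measurable A -> (forall i, measurable (g @^-1` [set i])) ->
  P A = (\sum_i P (A `&` g @^-1` [set i]))%E.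
Proof.
move=> mA mg.
rewrite [RHS]fsbig_seq ?index_enum_uniq//.
rewrite -measure_fin_bigcup//; last 2 first.
- by move=> i j _ _ [w [[_ /= <-] [_ <-]]].
- by move=> i _; exact: measurableI.
congr (P _); apply/seteqP; split=> [w Aw|w [i _ []]//].
by exists (g w) => //=; exact: mem_index_enum.
Qed.

Definition box_seq (I : Type) (t : nat -> I) d (T : measurableType d)
    (xi : nat -> {mfun T >-> nat}) n (w : T) : seq I :=
  [seq t (xi k w) | k <- iota 0 n].

Section pushforward_to_finType.
Variables (R : realType) (p : probability nat R) (I : finType) (t : nat -> I).

Definition box_prob (i : I) : R := fine (p (t @^-1` [set i])).

Lemma box_prob_ge0 i : 0 <= box_prob i.
Proof. by rewrite fine_ge0. Qed.

Lemma sum_box_prob : \sum_i box_prob i = 1.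
Proof.
apply: EFin_inj; rewrite -sumEFin.
rewrite -(@probability_setT _ _ _ p) (@measure_partition _ _ _ p I t)//.
by apply: eq_bigr => i _; rewrite setTI fineK// fin_num_measure.
Qed.

Variables (d : measure_display) (T : measurableType d) (P : probability T R).
Variables (xi : nat -> {RV P >-> nat}) (xi_iid : iid P xi p).

Local Notation bseq := (box_seq t xi).

Lemma measurable_box_seq n (Q : pred (seq I)) : measurable [set w | Q (bseq n w)].
Proof.
have := @measurable_fun_iota _ _ xi (fun s => Q (map t s) : nat) n.
move=> /(_ measurableT [set 1%N] Logic.I); rewrite setTI.
congr measurable; apply/seteqP; split=> w /=; rewrite /box_seq -map_comp.
  by case: (Q _).
by move=> ->.
Qed.

Lemma box_seq_law (s : seq I) :
  P [set w | bseq (size s) w = s] = (\prod_(x <- s) box_prob x)%:E.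
Proof.
pose x0 := t 0%N; have [indep law] := xi_iid.
pose J := [fset i in iota 0 (size s)]%fset.
have JE i : (i \in J) = (i < size s)%N by rewrite !inE mem_iota.
pose B i := t @^-1` [set nth x0 s i].
rewrite [X in P X](_ : _ = \bigcap_(i in [set` J]) (xi i @^-1` B i)); last first.
  apply/seteqP; split=> [w /= ws i|w /= ws].
    rewrite /= JE => si.
    by rewrite /B/= -[in RHS]ws (nth_map 0%N) ?size_iota// nth_iota.
  apply: (@eq_from_nth _ x0); rewrite size_map size_iota// => i si.
  rewrite (nth_map 0%N) ?size_iota// nth_iota//.
  by apply: ws; rewrite /= JE.
rewrite indep// (perm_big (iota 0 (size s))) /=; last first.
  apply: uniq_perm; rewrite ?iota_uniq ?fset_uniq// => i.
  by rewrite JE mem_iota.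
rewrite (eq_bigr (fun i => (box_prob (nth x0 s i))%:E)) => [|i _]; last first.
  have := law i (B i) Logic.I; rewrite /distribution /pushforward => ->.
  by rewrite /box_prob fineK// fin_num_measure.
rewrite prodEFin; congr EFin.
by rewrite -[in RHS](mkseq_nth x0 s) /mkseq big_map.
Qed.

(** Induction on the number [n] of remaining draws for an arbitrary observed prefix [s].
    Partitioning by the next draw lengthens the prefix and matches one unfolding of [Edraw]. *)
Lemma box_set_law n (Q : pred {set I}) (s : seq I) :
  P ([set w | bseq (size s) w = s] `&`
     [set w | Q [set:: bseq (size s + n) w]]) =
  (\prod_(x <- s) box_prob x *
   Edraw box_prob n (fun S => (Q S)%:R) [set:: s])%:E.
Proof.
elim: n s => [|n IHn] s /=.
  rewrite addn0; case: (boolP (Q [set:: s])) => Qs.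
    rewrite mulr1 -box_seq_law; congr (P _).
    by apply/seteqP; split=> [w []//|w /= ws]; split=> //=; rewrite ws.
  rewrite mulr0 [X in P X](_ : _ = set0) ?measure0//.
  by apply/seteqP; split=> // w [/= ws]; rewrite ws; exact/negP.
have mseq m (s' : seq I) : measurable [set w | bseq m w = s'].
  have := measurable_box_seq m (fun r => r == s').
  congr measurable; apply/seteqP; split=> w /=; first by move/eqP.
  by move=> ->.
rewrite (@measure_partition _ _ _ P I (fun w => t (xi (size s) w))); last 2 first.
- by apply: measurableI => //; exact: (measurable_box_seq _ (fun r => Q [set:: r])).
- by move=> i; exact: (measurable_funPTI (xi (size s)) (Y := t @^-1` [set i]) Logic.I).
rewrite mulr_sumr -sumEFin; apply: eq_bigr => x _.
have box_seqS w : bseq (size s).+1 w = rcons (bseq (size s) w) (t (xi (size s) w)).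
  by rewrite /box_seq -addn1 iotaD map_cat /= cats1.
have -> : x |: [set:: s]%SET = [set:: rcons s x]%SET.
  by apply/setP => y; rewrite !inE mem_rcons inE.
have := IHn (rcons s x); rewrite size_rcons addSnnS big_rcons /= => IH.
rewrite mulrCA mulrA [box_prob x * _]mulrC -IH; congr (P _).
apply/seteqP; split=> [w [[/= ws wQ] wx]|w [/= + wQ]].
  by split=> //=; rewrite box_seqS ws wx.
by rewrite box_seqS => /rcons_inj[ws wx]; split.
Qed.

Lemma card_box_law n (Q : pred {set I}) :
  P [set w | Q [set:: bseq n w]] =
  (Edraw box_prob n (fun S => (Q S)%:R) finset.set0)%:E.
Proof.
have := box_set_law n Q [::]; rewrite big_nil mul1r add0n.
rewrite (_ : [set:: [::]]%SET = finset.set0); last by apply/setP => i; rewrite !inE.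
move=> <-; congr (P _).
by apply/seteqP; split=> w /=; [move=> ?; split|case].
Qed.

End pushforward_to_finType.

(** * Asymptotics of the mean and of the variance *)

Section exponential_approximation.
Variable R : realType.

(** Factor the difference of the powers of [expR (- x)] and [1 - x]: the bases differ by at most
    [x ^+ 2], and the remaining sum is at most the exponent times a power of [expR (- x)], which
    absorbs one factor [x]. *)
Lemma expR_pow_approx (x : R) n : 0 <= x <= 1 ->
  0 <= expR (- (n%:R * x)) - (1 - x) ^+ n <= 2 * x.
Proof.
case/andP => x0 x1; case: n => [|n].
  by rewrite mul0r oppr0 expR0 expr0 subrr lexx mulr_ge0.
have b0 : 0 <= 1 - x by rewrite subr_ge0.
have ab : 1 - x <= expR (- x) := expR_ge1Dx (- x).
(* This follows from [expR x >= 1 + x] and [(1 + x) * (1 - x + x ^+ 2) = 1 + x ^+ 3 >= 1]. *)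
have aV : expR (- x) <= 1 - x + x ^+ 2.
  rewrite expRN invf_ple ?posrE ?expR_gt0//; last by nra.
  apply: le_trans (expR_ge1Dx x).
  rewrite -[leLHS]mul1r ler_pdivrMr; last by nra.
  have : 0 <= x ^+ 3 by rewrite exprn_ge0.
  nra.
have xe : n.+1%:R * x * expR (- (n%:R * x)) <= 2.
  have nx : (1 + n%:R * x) * expR (- (n%:R * x)) <= 1.
    by rewrite expRN ler_pdivrMr ?expR_gt0// mul1r; exact: expR_ge1Dx.
  have := expR_ge0 (- (n%:R * x)).
  have : expR (- (n%:R * x)) <= 1 by rewrite -expR0 ler_expR oppr_le0 mulr_ge0.
  rewrite -natr1; nra.
have powE m : expR (- (m%:R * x)) = expR (- x) ^+ m.
  by rewrite -expRM_natl mulrN.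
rewrite powE subrXX; set S := \sum_(_ < _) _.
have S0 : 0 <= S by apply: sumr_ge0 => i _; rewrite mulr_ge0 ?exprn_ge0 ?expR_ge0.
rewrite mulr_ge0 ?subr_ge0//=.
have Sle : S <= n.+1%:R * expR (- (n%:R * x)).
  rewrite powE mulr_natl -[X in _ *+ X]card_ord -sumr_const; apply: ler_sum => i _.
  apply: le_trans (_ : expR (- x) ^+ (n.+1.-1 - i) * expR (- x) ^+ i <= _).
    by apply: ler_wpM2l; [rewrite exprn_ge0 ?expR_ge0|apply: lerXn2r; rewrite ?nnegrE ?expR_ge0].
  by rewrite -exprD subnK// -ltnS.
apply: (@le_trans _ _ (x ^+ 2 * S)); first by apply: ler_wpM2r => //; lra.
apply: (@le_trans _ _ (x ^+ 2 * (n.+1%:R * expR (- (n%:R * x))))).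
  by apply: ler_wpM2l => //; exact: sqr_ge0.
have -> : x ^+ 2 * (n.+1%:R * expR (- (n%:R * x))) =
  n.+1%:R * x * expR (- (n%:R * x)) * x by ring.
exact: (ler_wpM2r x0 xe).
Qed.

Variables (I : finType) (w : I -> R).
Hypotheses (w_ge0 : forall i, 0 <= w i) (w_sum : \sum_i w i = 1).

Lemma sum_expR_pow_approx n :
  \sum_i `|expR (- (n%:R * w i)) - (1 - w i) ^+ n| <= 2.
Proof.
rewrite -[leRHS]mulr1 -[X in 2 * X]w_sum mulr_sumr; apply: ler_sum => i _.
have /andP[h0 h1] : 0 <= expR (- (n%:R * w i)) - (1 - w i) ^+ n <= 2 * w i.
  by apply: expR_pow_approx; rewrite w_ge0 (w_le1 w_ge0 w_sum).
by rewrite (ger0_norm h0).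
Qed.

Lemma mean_card_approx n :
  `|mean_card w n - \sum_i (1 - expR (- (n%:R * w i)))| <= 2.
Proof.
apply: le_trans (sum_expR_pow_approx n); rewrite /mean_card -sumrB.
apply: (le_trans (ler_norm_sum _ _ _)); apply: ler_sum => i _.
by rewrite /avoid_prob opprB addrCA addrAC subrr add0r.
Qed.

(** The map [y * (1 - y)] is 1-Lipschitz on the unit interval, so the bound for the powers
    themselves carries over. *)
Lemma var_proxy_approx n :
  `|var_proxy w n -
    \sum_i expR (- (n%:R * w i)) * (1 - expR (- (n%:R * w i)))| <= 2.
Proof.
apply: le_trans (sum_expR_pow_approx n); rewrite /var_proxy -sumrB.
apply: (le_trans (ler_norm_sum _ _ _)); apply: ler_sum => i _.
have := avoid_prob_ge0 w_ge0 w_sum n i; have := avoid_prob_le1 w_ge0 w_sum n i.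
rewrite /avoid_prob; set q := (1 - w i) ^+ n; set e := expR _ => q1 q0.
have e0 : 0 <= e := expR_ge0 _.
have e1 : e <= 1 by rewrite /e -expR0 ler_expR oppr_le0 mulr_ge0.
rewrite distrC (_ : e * (1 - e) - q * (1 - q) = (e - q) * (1 - e - q)); last by ring.
rewrite normrM ler_piMr// ler_norml; apply/andP; split; lra.
Qed.

End exponential_approximation.

(** * Merging all boxes beyond a level *)

Section truncation.
Variables (R : realType) (p : probability nat R).

(* The box [ord_max] collects the values [k >= N]; its weight is [tail N]. *)
Definition trunc N (k : nat) : 'I_N.+1 := inord (minn k N).
Definition tail N : R := 1 - \sum_(0 <= i < N) mass p i.

Lemma mass_ge0 i : 0 <= mass p i.
Proof. by rewrite fine_ge0. Qed.

Lemma box_prob_trunc N (i : 'I_N) :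
  box_prob p (trunc N) (widen_ord (leqnSn N) i) = mass p i.
Proof.
congr (fine (p _)); apply/seteqP; split=> k /=; rewrite /trunc.
  move/(congr1 val) => /=; rewrite inordK ?ltnS ?geq_minr// => ki.
  have : (minn k N < N)%N by rewrite ki /=.
  by rewrite gtn_min ltnn orbF => kN; rewrite -ki; apply/esym/minn_idPl/ltnW.
move=> ->; apply: val_inj; rewrite /= inordK ?ltnS ?geq_minr//.
by apply/minn_idPl; exact: ltnW.
Qed.

Lemma box_prob_max N : box_prob p (trunc N) ord_max = tail N.
Proof.
have := sum_box_prob p (trunc N); rewrite big_ord_recr/=.
under eq_bigr do rewrite box_prob_trunc.
by rewrite /tail big_mkord => <-; rewrite addrAC subrr add0r.
Qed.

Lemma tail_ge0 N : 0 <= tail N.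
Proof. by rewrite -box_prob_max box_prob_ge0. Qed.

Lemma cvg_tail : tail N @[N --> \oo] --> 0.
Proof.
rewrite -(subrr 1); apply: cvgB; first exact: cvg_cst.
have U : \bigcup_i [set i] = [set: nat] by apply/seteqP; split=> // i _; exists i.
have h : (\sum_(0 <= i < n) p [set i])%E @[n --> \oo] --> 1%E.
  rewrite -(@probability_setT _ _ _ p) -U; apply: measure_semi_sigma_additive => //.
  by move=> i j _ _ [x [/= -> ->]].
suff h' : (\sum_(0 <= i < n) mass p i)%:E @[n --> \oo] --> 1%E by exact: (fine_cvg h').
move: h; apply: cvg_trans; apply: near_eq_cvg; apply: nearW => n.
by rewrite -sumEFin; apply: eq_bigr => i _; rewrite fineK// fin_num_measure.
Qed.

Lemma mu_tail t N : 0 <= t ->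
  0 <= mu p t - \sum_(0 <= i < N) (1 - expR (- (t * mass p i))) <= t * tail N.
Proof.
move=> t0; pose u i := 1 - expR (- (t * mass p i)).
have u0 i : 0 <= u i.
  by rewrite subr_ge0 -expR0 ler_expR oppr_le0 mulr_ge0 ?mass_ge0.
have cu := @is_cvg_series_mu _ p _ t0.
have nd : nondecreasing_seq (series u) by apply/nondecreasing_series => i _ _; exact: u0.
apply/andP; split.
  by rewrite subr_ge0; exact: (nondecreasing_cvgn_le nd cu N).
rewrite lerBlDr; apply: limr_le => //; near=> m.
have Nm : (N <= m)%N by near: m; exists N.
rewrite seriesEnat /= (big_cat_nat (leq0n N) Nm)//= addrC lerD2r.
have -> : tail N = tail m + \sum_(N <= i < m) mass p i.
  by rewrite /tail (big_cat_nat (leq0n N) Nm)//=; ring.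
apply: (@le_trans _ _ (t * \sum_(N <= i < m) mass p i)).
  rewrite mulr_sumr; apply: ler_sum => i _.
  by rewrite lerBlDr -lerBlDl; exact: expR_ge1Dx.
by apply: ler_wpM2l => //; rewrite lerDr tail_ge0.
Unshelve. all: by end_near. Qed.

Section estimates.
Variables (n N : nat).
Hypothesis tail_small : n%:R * tail N <= 1.
Notation w := (box_prob p (trunc N)).

Let n_tail_ge0 : 0 <= n%:R * tail N :> R.
Proof. by rewrite mulr_ge0 ?tail_ge0. Qed.

Let sum_trunc (f : R -> R) :
  \sum_i f (w i) = \sum_(0 <= i < N) f (mass p i) + f (tail N).
Proof.
rewrite big_ord_recr /= box_prob_max big_mkord; congr (_ + _).
by apply: eq_bigr => i _; rewrite box_prob_trunc.
Qed.

Let one_expR (x : R) : 0 <= x -> 0 <= 1 - expR (- x) <= x.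
Proof.
move=> x0; rewrite subr_ge0 -{1}expR0 ler_expR oppr_le0 x0/=.
by rewrite lerBlDr -lerBlDl; exact: expR_ge1Dx.
Qed.

(** The 4 collects 2 from the exponential approximation, 1 from the omitted tail of [mu] and 1 from
    the merged box. *)
Lemma mean_card_mu : `|mean_card w n - mu p n%:R| <= 4.
Proof.
have h := mean_card_approx (box_prob_ge0 p (trunc N)) (sum_box_prob p (trunc N)) n.
have /= E := sum_trunc (fun x => 1 - expR (- (n%:R * x))).
rewrite E in h => {E}.
have := mu_tail N (ler0n R n).
have := one_expR n_tail_ge0; move: h.
rewrite !ler_norml; set M := mean_card _ _; set U := mu _ _; set e := expR _.
set S := \sum_(0 <= i < N) _; move: tail_small; set y := n%:R * tail N.
move=> ? /andP[? ?] /andP[? ?] /andP[? ?].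
by apply/andP; split; lra.
Qed.

Let var_arith (V S1 S2 U1 U2 e y : R) : y <= 1 -> 0 <= e ->
    `|V - (S2 - S1 + e * (1 - e))| <= 2 -> 0 <= U2 - S2 <= 2 * y ->
    0 <= U1 - S1 <= y -> 0 <= 1 - e <= y -> `|V - (U2 - U1)| <= 6.
Proof.
move=> y1 e0; rewrite !ler_norml => /andP[? ?] /andP[? ?] /andP[? ?] /andP[? ?].
have e1 : e <= 1 by lra.
have ee : e * (1 - e) <= 1 - e by rewrite ler_piMl// subr_ge0.
have ee0 : 0 <= e * (1 - e) by rewrite mulr_ge0// subr_ge0.
by apply/andP; split; lra.
Qed.

Lemma var_proxy_mu :
  `|var_proxy w n - (mu p (2 * n%:R) - mu p n%:R)| <= 6.
Proof.
have h := var_proxy_approx (box_prob_ge0 p (trunc N)) (sum_box_prob p (trunc N)) n.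
have /= E := sum_trunc (fun x => expR (- (n%:R * x)) * (1 - expR (- (n%:R * x)))).
rewrite E in h => {E}.
have h2 := mu_tail N (mulr_ge0 (ler0n R 2) (ler0n R n)).
rewrite -(mulrA 2 n%:R (tail N)) in h2.
have h1 := mu_tail N (ler0n R n).
have he := one_expR n_tail_ge0.
have e0 := expR_ge0 (- (n%:R * tail N)).
(* Termwise, [e * (1 - e) = (1 - e ^+ 2) - (1 - e)] for [e = expR (- (n%:R * mass p i))]; this is
   how [mu] at [2 * n] enters the variance. *)
have : \sum_(0 <= i < N) expR (- (n%:R * mass p i)) * (1 - expR (- (n%:R * mass p i)))
  = \sum_(0 <= i < N) (1 - expR (- (2 * n%:R * mass p i))) -
    \sum_(0 <= i < N) (1 - expR (- (n%:R * mass p i))).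
  rewrite -sumrB; apply: eq_bigr => i _.
  have -> : - (2 * n%:R * mass p i) = - (n%:R * mass p i) + - (n%:R * mass p i) by ring.
  by rewrite expRD; ring.
move=> E; rewrite E in h.
exact: (var_arith tail_small e0 h h2 h1 he).
Qed.

Lemma hit_once_tail k : (0 < n)%N -> (k <= N)%N -> tail k <= 2^-1 ->
  n%:R * hit_once w n ^+ 2 <=
  2 * k%:R ^+ 2 / n%:R + 4 * tail k * var_proxy w n.
Proof.
move=> n0 kN tk.
(* The exceptional boxes are the first [k]; as [k <= N], the merged box counts among the light
   ones. *)
pose K : {set 'I_N.+1} := [set i : 'I_N.+1 | (i < k)%N]%SET.
have cK : #|K| = k.
  rewrite -sum1_card (eq_bigl (fun i : 'I_N.+1 => (i < k)%N)) => [|i]; last by rewrite inE.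
  by rewrite -(big_ord_widen N.+1 (fun=> 1%N)) ?sum1_card ?card_ord// ltnW.
have tK : \sum_(i | i \notin K) w i = tail k.
  rewrite big_mkcond big_ord_recr /= inE /= -leqNgt kN box_prob_max.
  rewrite (eq_bigr (fun i : 'I_N => if (k <= i)%N then mass p i else 0)) => [|i _]; last first.
    by rewrite inE -leqNgt /= box_prob_trunc.
  rewrite -big_mkcond /= (_ : \sum_(i < N | (k <= i)%N) mass p i = \sum_(k <= i < N) mass p i);
    last by rewrite big_geq_mkord.
  rewrite /tail (big_cat_nat (leq0n k) kN)//=; ring.
have := hit_once_bound (box_prob_ge0 p (trunc N)) (sum_box_prob p (trunc N)) n0 (K := K).
by rewrite tK cK; apply.
Qed.

End estimates.
End truncation.

(** * From occupied boxes back to distinct values *)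

Section standardized_occupancy.
Variables (R : realType) (p : probability nat R).

Lemma one_sub_pow_le (x : R) n : 0 <= x <= 1 -> 1 - (1 - x) ^+ n <= n%:R * x.
Proof.
case/andP => x0 x1; elim: n => [|n IHn]; first by rewrite expr0 subrr mul0r.
have y0 : 0 <= 1 - x by rewrite subr_ge0.
have y1 : (1 - x) ^+ n <= 1 by rewrite exprn_ile1// gerBl.
have y2 : 0 <= (1 - x) ^+ n by rewrite exprn_ge0.
rewrite exprS -natr1; nra.
Qed.

(** As long as the merged box is not hit, [trunc] loses nothing on the sampled values, so distinct
    values and occupied boxes correspond. *)
Lemma nb_distinct_box (d : measure_display) (T : measurableType d)
    (xi : nat -> {mfun T >-> nat}) N n w :
    ord_max \notin [set:: box_seq (trunc N) xi n w]%SET ->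
  nb_distinct xi n w = #|[set:: box_seq (trunc N) xi n w]%SET|.
Proof.
rewrite inE => maxN; rewrite /nb_distinct.
set s := box_seq _ _ _ _ in maxN *.
have -> : [seq xi k w | k <- iota 0 n] = map val s.
  rewrite /s /box_seq -map_comp; apply/eq_in_map => k kn /=.
  rewrite /trunc inordK ?ltnS ?geq_minr//; apply/esym/minn_idPl.
  rewrite leqNgt; apply/negP => Nxi; move/negP: maxN; apply.
  apply/mapP; exists k => //; apply: val_inj => /=.
  by rewrite /trunc inordK ?ltnS ?geq_minr//; apply/esym/minn_idPr/ltnW.
rewrite undup_map_inj ?size_map; last exact: val_inj.
rewrite cardsE -(card_uniqP (undup_uniq s)); apply: eq_card => i.
by rewrite mem_undup.
Qed.

Variables (d : measure_display) (T : measurableType d) (P : probability T R).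
Variables (xi : nat -> {RV P >-> nat}) (xi_iid : iid P xi p).

Definition stdz_mean n N (m s : R) (f : R -> R) : R :=
  Edraw (box_prob p (trunc N)) n (fun S => f (stdz m s #|S|)) finset.set0.

(** Intersect with the event that the merged box stays empty; its complement has probability at most
    [n * tail p N]. One direction is enough, since it is applied to a set and to its complement. *)
Lemma le_stdz_mean n N (m s : R) (B : pred R) :
    measurable [set y | B y] ->
  stdz_mean n N m s (fun y => (B y)%:R) - n%:R * tail p N <=
  fine (P (standardized (nb_distinct xi n) m s @^-1` [set y | B y])).
Proof.
move=> mB; set w := box_prob p (trunc N).
have w0 := box_prob_ge0 p (trunc N); have w1 := sum_box_prob p (trunc N).
pose Q (S : {set 'I_N.+1}) := B (stdz m s #|S|) && (ord_max \notin S).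
apply: (@le_trans _ _ (fine (P [set v | Q [set:: box_seq (trunc N) xi n v]%SET]))).
  rewrite (card_box_law (trunc N) xi_iid) /=.
  have avoid : 1 - n%:R * tail p N <=
      Edraw w n (fun S => (ord_max \notin S)%:R) finset.set0.
    rewrite Edraw_avoid ?inE// /w box_prob_max lerBlDr addrC -lerBlDr.
    apply: one_sub_pow_le; rewrite tail_ge0 -box_prob_max.
    by rewrite (w_le1 w0 w1).
  have : stdz_mean n N m s (fun y => (B y)%:R) +
      Edraw w n (fun S => (ord_max \notin S)%:R) finset.set0 -
      Edraw w n (fun=> 1) finset.set0 <=
      Edraw w n (fun S => (Q S)%:R) finset.set0.
    rewrite /stdz_mean -EdrawD -EdrawB; apply: le_Edraw => // S _.
    rewrite /Q; case: (B _); case: (_ \notin _) => /=; lra.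
  rewrite Edraw_cst//; lra.
have mQ : measurable [set v | Q [set:: box_seq (trunc N) xi n v]%SET].
  exact: (measurable_box_seq _ _ _ (fun r => Q [set:: r]%SET)).
have mW := measurable_funPTI (standardized (nb_distinct xi n) m s) mB.
apply: fine_le; rewrite ?fin_num_measure//; apply: le_measure; rewrite ?inE//.
move=> v /= /andP[Bv vN].
by change (B (((nb_distinct xi n v)%:R - m) / s)); rewrite (nb_distinct_box vN).
Qed.

End standardized_occupancy.

(** * The error in Stein's identity vanishes *)

Section stein_error.
Variables (R : realType) (p : probability nat R) (N : nat -> nat).
Hypothesis N_ge : forall n, (n <= N n)%N.
Hypothesis N_tail : forall n, n%:R * tail p (N n) <= 1.
Hypothesis sigma_oo : sigma p n%:R @[n --> \oo] --> +oo.

Notation w n := (box_prob p (trunc (N n))).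
Notation s n := (sigma p n%:R).

(** A level [k] is fixed first to make the light mass [tail p k] small; then [n] grows, and all that
    is not proportional to this mass is of order [1 / s n]. *)
Lemma stein_error_cvg :
  `|mean_card (w n) n - mu p n%:R| / s n +
  `|var_proxy (w n) n - s n ^+ 2| / s n ^+ 2 +
  var_proxy (w n) n / s n ^+ 3 +
  n%:R * hit_once (w n) n ^+ 2 / s n ^+ 2 @[n --> \oo] --> 0.
Proof.
apply/cvgrPdist_le => e e0.
(* The light boxes contribute [4 * tail p k * v] with [v <= 7 * s n ^+ 2], hence [28 * tail p k],
   which [e / 56] brings down to [e / 2]. *)
have [k tk] : exists k, tail p k <= Num.min 2^-1 (e / 56).
  have e1 : 0 < Num.min 2^-1 (e / 56) by rewrite lt_min invr_gt0 ltr0n divr_gt0.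
  have /cvgrPdist_le/(_ _ e1)[k _ /(_ k (leqnn k))/=] := cvg_tail p.
  by rewrite sub0r normrN ger0_norm ?tail_ge0// => ?; exists k.
move: tk; rewrite le_min => /andP[tk2 tke].
(* Here 17 is 4 + 6 + 7, from the bounds [B1], [B2] and [B3]; the rest comes from the first [k]
   boxes in [B4]. *)
pose c : R := 17 + 2 * k%:R ^+ 2.
near=> n.
have n0 : (0 < n)%N by near: n; exists 1%N.
have kn : (k <= N n)%N.
  by apply: leq_trans (N_ge n); near: n; exists k.
have s1 : 1 <= s n by near: n; apply: cvgry_ge sigma_oo _.
have sc : 2 * c / e <= s n by near: n; apply: cvgry_ge sigma_oo _.
have s0 : 0 < s n by rewrite (lt_le_trans _ s1).
have hM := mean_card_mu (N_tail n).
have hv := var_proxy_mu (N_tail n).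
have s2 : s n ^+ 2 = mu p (2 * n%:R) - mu p n%:R.
  by rewrite sqr_sqrtr// ltW// -sqrtr_gt0.
rewrite -s2 in hv.
have hH := hit_once_tail n0 kn tk2.
have v0 := var_proxy_ge0 (box_prob_ge0 p (trunc (N n))) (sum_box_prob p (trunc (N n))) n.
have t0 := tail_ge0 p k.
set v := var_proxy _ _ in hv hH v0 *; set M := `|_ - mu p _| in hM *.
set H := n%:R * _ in hH *.
have H0 : 0 <= H by rewrite mulr_ge0 ?sqr_ge0.
have k2 : 2 * k%:R ^+ 2 / n%:R <= 2 * k%:R ^+ 2 :> R.
  rewrite ler_pdivrMr ?ltr0n// ler_peMr ?mulr_ge0 ?exprn_ge0//.
  by rewrite ler1n.
have s0' := ltW s0.
have sq1 : s n <= s n ^+ 2 by rewrite expr2 ler_peMr.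
have sq2 : 1 <= s n ^+ 2 by rewrite (le_trans s1).
have v7 : v <= 7 * s n ^+ 2.
  by move: hv; rewrite ler_norml => /andP[]; lra.
have sV : 0 <= (s n)^-1 by rewrite invr_ge0.
have B1 : M / s n <= 4 / s n by rewrite ler_wpM2r.
have B2 : `|v - s n ^+ 2| / s n ^+ 2 <= 6 / s n.
  rewrite ler_pdivrMr ?exprn_gt0// mulrAC ler_pdivlMr//.
  by apply: ler_pM.
have B3 : v / s n ^+ 3 <= 7 / s n.
  rewrite ler_pdivrMr ?exprn_gt0// (_ : 7 / s n * s n ^+ 3 = 7 * s n ^+ 2)//.
  by field; rewrite gt_eqF.
have B4 : H / s n ^+ 2 <= 2 * k%:R ^+ 2 / s n + 28 * tail p k.
  rewrite ler_pdivrMr ?exprn_gt0//.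
  have -> : (2 * k%:R ^+ 2 / s n + 28 * tail p k) * s n ^+ 2 =
    2 * k%:R ^+ 2 * s n + 4 * tail p k * (7 * s n ^+ 2).
    by field; rewrite gt_eqF.
  apply: (le_trans hH); apply: lerD; last first.
    by apply: ler_wpM2l => //; rewrite mulr_ge0.
  by apply: (le_trans k2); rewrite ler_peMr// mulr_ge0// exprn_ge0.
have B5 : c / s n <= e / 2.
  rewrite ler_pdivrMr//; move: sc; rewrite ler_pdivrMr//; lra.
rewrite sub0r normrN ger0_norm; last first.
  by rewrite !addr_ge0 ?divr_ge0 ?exprn_ge0// normr_ge0.
apply: (@le_trans _ _ (c / s n + 28 * tail p k)); last by lra.
by rewrite /c !mulrDl; lra.
Unshelve. all: by end_near. Qed.

End stein_error.

(** * The central limit theorem *)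

Theorem theorem1p1 (R : realType) (p : probability nat R)
    (p_decr : forall i, 0 < mass p i.+1 <= mass p i)
    (d : measure_display) (T : measurableType d) (P : probability T R)
    (xi : nat -> {RV P >-> nat}) (xi_iid : iid P xi p)
    (sigma_oo : sigma p n%:R @[n --> \oo] --> +oo) :
  cvg_in_distribution P
    (fun n => standardized (nb_distinct xi n) (mu p n%:R) (sigma p n%:R))
    (normal_prob (0 : R) 1).
Proof.
(* The truncation level is so high that the probability that [n] draws hit the merged box is at most
   [1 / (n + 1)]; [n <= N] keeps any fixed number of boxes unmerged eventually. *)
have [n|N N_spec] := @choice nat nat
    (fun n N => (n <= N)%N /\ n%:R * tail p N <= n.+1%:R^-1).
  have e0 : 0 < (n.+1%:R^-1 / n.+1%:R : R) by rewrite divr_gt0 ?invr_gt0 ?ltr0n.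
  have /cvgrPdist_le/(_ _ e0)[k _ kP] := cvg_tail p.
  exists (maxn n k); split; first exact: leq_maxl.
  have := kP _ (leq_maxr n k); rewrite /= sub0r normrN ger0_norm ?tail_ge0//.
  rewrite ler_pdivlMr ?ltr0n// mulrC; apply: le_trans.
  by apply: ler_wpM2r; rewrite ?tail_ge0// ler_nat.
have N_ge n : (n <= N n)%N by have [] := N_spec n.
have N_tail n : n%:R * tail p (N n) <= n.+1%:R^-1 by have [] := N_spec n.
have N_tail1 n : n%:R * tail p (N n) <= 1.
  by apply: (le_trans (N_tail n)); rewrite invf_le1 ?ltr0n// ler1n.
pose La n := stdz_mean p n (N n) (mu p n%:R) (sigma p n%:R).
have w0 n := box_prob_ge0 p (trunc (N n)).
have w1 n := sum_box_prob p (trunc (N n)).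
have LaB n f g : La n (fun x => f x - g x) = La n f - La n g by exact: EdrawB.
have LaZ n c f : La n (fun x => c * f x) = c * La n f by exact: EdrawZ.
have La_le n (f g : R -> R) : (forall x, f x <= g x) -> La n f <= La n g.
  by move=> fg; apply: le_Edraw.
have La_cst n c : La n (fun=> c) = c by exact: Edraw_cst.
have La_stein C F dF : stein_test C F dF ->
    La n (fun x => x * F x - dF x) @[n --> \oo] --> 0.
  move=> [FC dFC FL FT].
  pose w n := box_prob p (trunc (N n)); pose s n := sigma p n%:R.
  have err0 : C * (`|mean_card (w n) n - mu p n%:R| / s n +
      `|var_proxy (w n) n - s n ^+ 2| / s n ^+ 2 +
      var_proxy (w n) n / s n ^+ 3 +
      n%:R * hit_once (w n) n ^+ 2 / s n ^+ 2) @[n --> \oo] --> 0.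
    rewrite -(mulr0 C); apply: cvgM; first exact: cvg_cst.
    exact: stein_error_cvg.
  apply/cvgrPdist_le => e e0.
  have /cvgrPdist_le/(_ e e0) := err0.
  (* [stein_bound] divides by the standard deviation, which is positive only from some [n] on. *)
  apply: filterS2 (cvgry_gt sigma_oo (0 : R)) => n s0 hn.
  rewrite sub0r normrN; apply: le_trans hn.
  rewrite sub0r normrN; apply: le_trans (ler_norm _); exact: stein_bound.
move=> x _; set nu := normal_prob 0 1.
(* The normal law has no atom, so the bounds of [stein_le] and [stein_gt] close up to the same
   limit. *)
have nu_lt : fine (nu `]-oo, x[%classic) = fine (nu `]-oo, x]%classic).
  congr fine; rewrite /nu /normal_prob; apply: integral_itv_bndo_bndc.
  by apply/measurable_EFinP/measurable_funTS; exact: measurable_normal_pdf.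
have nu_gt : fine (nu `]x, +oo[%classic) = 1 - fine (nu `]-oo, x]%classic).
  have := @probability_setC _ _ _ (normal_prob (0 : R) 1) `]-oo, x]%classic (measurable_itv _).
  by rewrite setCitvl /nu => ->; rewrite fineB ?fin_num_measure.
rewrite -[X in _ --> X]fineK ?fin_num_measure//.
apply: (@cvg_trans _ ((fine (cdf (standardized (nb_distinct xi n) (mu p n%:R)
  (sigma p n%:R) : {RV P >-> R}) x))%:E @[n --> \oo])).
  by apply: near_eq_cvg; apply: nearW => n; rewrite fineK// fin_num_measure.
apply/cvg_EFin; first by apply: nearW.
apply/cvgrPdist_le => e e0; have e20 : 0 < e / 2 by rewrite divr_gt0.
have le_x := stein_le LaB LaZ La_le La_cst La_stein x e20.
have gt_x := stein_gt LaB LaZ La_le La_cst La_stein x e20.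
near=> n => /=.
have n_small : n%:R * tail p (N n) <= e / 2.
  apply: (le_trans (N_tail n)); apply: ltW; near: n.
  exact: (near_infty_natSinv_lt (PosNum e20)).
set X : {RV P >-> R} := standardized _ _ _; set q := fine (cdf X x).
(* Half of [e] pays for the merged box, the other half for the limit of [La n]; [q_ge] bounds the
   distribution function from below and [q_le], through the complement, from above. *)
have q_ge : La n (fun y => (y <= x)%R%:R) - e / 2 <= q.
  apply: le_trans (_ : La n (fun y => (y <= x)%R%:R) - n%:R * tail p (N n) <= _).
    by rewrite lerD2l lerN2.
  have E : [set y | y <= x] = `]-oo, x]%classic by rewrite set_itvE.
  rewrite /q /cdf /distribution /pushforward -E; apply: le_stdz_mean => //.
  by rewrite E; exact: measurable_itv.
have q_le : La n (fun y => (x < y)%R%:R) - e / 2 <= 1 - q.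
  apply: le_trans (_ : La n (fun y => (x < y)%R%:R) - n%:R * tail p (N n) <= _).
    by rewrite lerD2l lerN2.
  have E : [set y | x < y] = `]x, +oo[%classic by rewrite set_itvE.
  have -> : 1 - q = fine (ccdf X x) by rewrite ccdf_1_cdf fineB ?fin_num_measure.
  rewrite /ccdf /distribution /pushforward -E; apply: le_stdz_mean => //.
  by rewrite E; exact: measurable_itv.
have h1 : fine (nu `]-oo, x[%classic) - e / 2 <= La n (fun y => (y <= x)%R%:R) by near: n.
have h2 : fine (nu `]x, +oo[%classic) - e / 2 <= La n (fun y => (x < y)%R%:R) by near: n.
rewrite nu_lt in h1; rewrite nu_gt in h2; rewrite ler_norml; apply/andP; split; lra.
Unshelve. all: by end_near. Qed.
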